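(* Let $k\geq 0$ be an integer. Every module $M$ in $\mathcal{U}_{k}$ has a projective resolution of length at most $k$, i.e. there is an exact sequence $0\to P_{k}\to\cdots\to P_{1}\to P_{0}\to M\to 0$ in $\mathcal{U}_{k}$ with all $P_i$ projective. In other words, the homological dimension of the category $\mathcal{U}_{k}$ is at most $k$.
   Context: A ringoid is a small preadditive category. A left module over a ringoid is a covariant additive functor from it to abelian groups; module maps are natural transformations. An ideal of a ringoid is a choice of subgroups of all morphism groups closed under composition on either side with arbitrary morphisms; quotients by ideals are formed on morphism groups. A subringoid has all objects, and its morphism sets are subgroups closed under composition and containing identities. Let $A$ be the mod 2 Steenrod algebra. Let $\mathcal{A}$ be the ringoid whose objects are all integers, with $\mathcal{A}(a,b)$ the degree $b-a$ part of $A$ and composition given by multiplication ($g\circ f=gf$). Let $\mathcal{Q}$ be the quotient of $\mathcal{A}$ by the ideal generated by the morphisms $\mathrm{Sq}^{i}:n\to n+i$ with $i\geq 0$ and $i>n$ (for $n<0$ this includes the identity $\mathrm{Sq}^0$ of $n$); left $\mathcal{Q}$-modules are exactly unstable $A$-modules. For $k\geq 0$ let $\mathcal{Q}_{k}$ be the subringoid of $\mathcal{Q}$ generated by the morphisms $\mathrm{Sq}^{i}:n\to n+i$ with $i\geq 0$ and $n-i<k$. $\mathcal{U}_{k}$ is the category of left $\mathcal{Q}_{k}$-modules; it is an abelian category. *)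

(* Defs.v *)
From HB Require Import structures.
From mathcomp Require Import all_boot all_order all_algebra ring_quotient.
From mathcomp.classical Require Import boolp.
From mathcomp.multinomials Require Import monalg.

Set Implicit Arguments.
Unset Strict Implicit.
Unset Printing Implicit Defensive.

Import Order.TTheory GRing.Theory Num.Theory.
Local Open Scope ring_scope.
Local Open Scope quotient_scope.

Record subgroup (V : zmodType) := Subgroup {
  sg_mem :> V -> Prop;
  sg0 : sg_mem 0;
  sgB : forall x y, sg_mem x -> sg_mem y -> sg_mem (x - y) }.

Inductive span (V : zmodType) (S : V -> Prop) : V -> Prop :=
  | span_gen x : S x -> span S x
  | span_zero : span S 0
  | span_sub x y : span S x -> span S y -> span S (x - y).

Definition spang (V : zmodType) (S : V -> Prop) : subgroup V :=
  Subgroup (span_zero S) (@span_sub V S).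

Section SubgroupTypes.
Variables (V : zmodType) (N : subgroup V).

Lemma sgN x : N x -> N (- x).
Proof. by move=> Nx; rewrite -sub0r; apply: sgB => //; apply: sg0. Qed.

Lemma sgD x y : N x -> N y -> N (x + y).
Proof. by move=> Nx Ny; rewrite -[y]opprK; apply: sgB => //; apply: sgN. Qed.

Definition sg_pred : V -> bool := fun x => `[< N x >].

Lemma sg_predP x : reflect (N x) (x \in sg_pred).
Proof. exact: asboolP. Qed.

Lemma sg_pred_closed : zmod_closed sg_pred.
Proof.
split=> [|x y /sg_predP Nx /sg_predP Ny]; apply/sg_predP.
- exact: sg0.
- exact: sgB.
Qed.

HB.instance Definition _ := GRing.isZmodClosed.Build V sg_pred sg_pred_closed.

Definition subg := {x : V | x \in sg_pred}.
HB.instance Definition _ := SubChoice.on subg.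
HB.instance Definition _ := [SubChoice_isSubZmodule of subg by <:].

Definition mk_subg (x : V) (Nx : N x) : subg := exist _ x (introT (sg_predP x) Nx).

Lemma subgP (u : subg) : N (val u).
Proof. exact/sg_predP/(valP u). Qed.

Definition sg_closed : zmodClosed V := GRing.ZmodClosed.clone V sg_pred _.
Definition quotg := {ideal_quot sg_closed}.
HB.instance Definition _ := GRing.Zmodule.on quotg.

End SubgroupTypes.

(* Locked, so that failing conversions do not unfold the choice of
   representatives. *)
HB.lock Definition piq (V : zmodType) (N : subgroup V) (x : V) : quotg N :=
  \pi_{ideal_quot sg_closed N} x.
HB.lock Definition reprq (V : zmodType) (N : subgroup V) (u : quotg N) : V :=
  repr (u : {ideal_quot sg_closed N}).

Section QuotientTheory.
Variables (V : zmodType) (N : subgroup V).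
Local Notation piq := (piq N).

Lemma reprqK : cancel (@reprq V N) piq.
Proof. by move=> u; rewrite piq.unlock reprq.unlock; apply: reprK. Qed.

Lemma piq_eqP x y : piq x = piq y <-> N (x - y).
Proof.
have E : (piq x == piq y) = (x - y \in sg_closed N).
  by rewrite piq.unlock (Quotient.idealrBE (sg_closed N)).
by split=> [/eqP|Nxy]; [rewrite E => /sg_predP | apply/eqP; rewrite E; apply/sg_predP].
Qed.

Lemma piq_is_zmod_morphism : zmod_morphism piq.
Proof. by rewrite piq.unlock; exact: (raddfB \pi_{ideal_quot sg_closed N}). Qed.

HB.instance Definition _ :=
  GRing.isZmodMorphism.Build V (quotg N) piq piq_is_zmod_morphism.

Lemma repr_piq x : N (reprq (piq x) - x).
Proof. by apply/piq_eqP; rewrite reprqK. Qed.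

End QuotientTheory.

Section RingQuotient.
Variables (R : pzRingType) (S : R -> Prop).

Inductive ideal_multiple : R -> Prop :=
  | IdealMultiple x s y : S s -> ideal_multiple (x * s * y).

Definition two_sided : subgroup R := spang ideal_multiple.

Lemma two_sided_gen s : S s -> two_sided s.
Proof.
move=> Ss; rewrite -[s]mul1r -[1 * s]mulr1.
exact/span_gen/IdealMultiple.
Qed.

Lemma two_sidedMl x r : two_sided r -> two_sided (x * r).
Proof.
elim=> [_ [y s z sS]||r1 r2 _ IH1 _ IH2].
- by rewrite !mulrA; apply/span_gen/IdealMultiple.
- by rewrite mulr0; apply: span_zero.
- by rewrite mulrBr; apply: span_sub.
Qed.

Lemma two_sidedMr x r : two_sided r -> two_sided (r * x).
Proof.
elim=> [_ [y s z sS]||r1 r2 _ IH1 _ IH2].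
- by rewrite -!mulrA mulrA; apply/span_gen/IdealMultiple.
- by rewrite mul0r; apply: span_zero.
- by rewrite mulrBl; apply: span_sub.
Qed.

Definition quotr := quotg two_sided.
HB.instance Definition _ := GRing.Zmodule.on quotr.

Definition pir : R -> quotr := @piq _ two_sided.

End RingQuotient.

HB.lock Definition quotr_mul (R : pzRingType) (S : R -> Prop) (x y : quotr S) :
  quotr S := pir S (reprq x * reprq y).

Section RingQuotientTheory.
Variables (R : pzRingType) (S : R -> Prop).
Local Notation quotr := (quotr S).
Local Notation pir := (pir S).
Local Notation quotr_mul := (@quotr_mul R S).

Definition quotr_one : quotr := pir 1.

Lemma pirD x y : pir (x + y) = pir x + pir y.
Proof. exact: (raddfD (@piq _ (two_sided S))). Qed.

Lemma pirM x y : quotr_mul (pir x) (pir y) = pir (x * y).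
Proof.
rewrite quotr_mul.unlock; apply/piq_eqP; set x' := reprq _; set y' := reprq _.
have -> : x' * y' - x * y = (x' - x) * y' + x * (y' - y).
  by rewrite mulrBl mulrBr addrA subrK.
apply: sgD; first exact/two_sidedMr/repr_piq.
exact/two_sidedMl/repr_piq.
Qed.

Lemma pirP (u : quotr) : exists x, u = pir x.
Proof. by exists (reprq u); rewrite [RHS]reprqK. Qed.

Lemma quotr_mulA : associative quotr_mul.
Proof.
move=> u v w; have [x ->] := pirP u; have [y ->] := pirP v.
by have [z ->] := pirP w; rewrite !pirM mulrA.
Qed.

Lemma quotr_mul1l : left_id quotr_one quotr_mul.
Proof. by move=> u; have [x ->] := pirP u; rewrite pirM mul1r. Qed.

Lemma quotr_mul1r : right_id quotr_one quotr_mul.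
Proof. by move=> u; have [x ->] := pirP u; rewrite pirM mulr1. Qed.

Lemma quotr_mulDl : left_distributive quotr_mul +%R.
Proof.
move=> u v w; have [x ->] := pirP u; have [y ->] := pirP v.
by have [z ->] := pirP w; rewrite -pirD !pirM mulrDl pirD.
Qed.

Lemma quotr_mulDr : right_distributive quotr_mul +%R.
Proof.
move=> u v w; have [x ->] := pirP u; have [y ->] := pirP v.
by have [z ->] := pirP w; rewrite -pirD !pirM mulrDr pirD.
Qed.

HB.instance Definition _ := GRing.Zmodule_isPzRing.Build quotr
  quotr_mulA quotr_mul1l quotr_mul1r quotr_mulDl quotr_mulDr.

Lemma pir_is_zmod_morphism : zmod_morphism pir.
Proof. exact: piq_is_zmod_morphism. Qed.

HB.instance Definition _ :=
  GRing.isZmodMorphism.Build R quotr pir pir_is_zmod_morphism.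

Lemma pir_is_monoid_morphism : monoid_morphism pir.
Proof. by split=> [//|x y]; exact/esym/pirM. Qed.

HB.instance Definition _ :=
  GRing.isMonoidMorphism.Build R quotr pir pir_is_monoid_morphism.

End RingQuotientTheory.

(* The free associative F_2-algebra on letters Sq^0, Sq^1, Sq^2, ... *)
Definition freeSq : pzRingType := {malg 'F_2[{fmonom nat}]}.

Definition letter (i : nat) : freeSq := << fmu i >>.

(* Sq^0 = 1 and the Adem relations
   Sq^a Sq^b = sum_{c <= a/2} C(b-c-1, a-2c) Sq^(a+b-c) Sq^c  for 0 < a < 2b. *)
Inductive adem_relator : freeSq -> Prop :=
  | adem_unit : adem_relator (letter 0 - 1)
  | adem_prod a b : (0 < a < 2 * b)%N ->
      adem_relator
        (letter a * letter b
         - \sum_(0 <= c < (a %/ 2).+1)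
             'C(b - c - 1, a - 2 * c)%:R * (letter (a + b - c) * letter c)).

Definition steenrod : pzRingType := quotr adem_relator.

Definition Sq (i : nat) : steenrod := pir adem_relator (letter i).

Lemma Sq0 : Sq 0 = 1.
Proof. exact/piq_eqP/two_sided_gen/adem_unit. Qed.

(* The degree n part is the additive span of the Sq^i1 ... Sq^ir with
   i1 + ... + ir = n; it is 0 for n < 0. *)
Inductive sq_monomial (n : int) : steenrod -> Prop :=
  | SqMonomial (s : seq nat) :
      (sumn s)%:Z = n -> sq_monomial n (\prod_(i <- s) Sq i).

Definition st_degree (n : int) : subgroup steenrod := spang (sq_monomial n).

Lemma st_degreeM m n x y :
  st_degree m x -> st_degree n y -> st_degree (m + n) (x * y).
Proof.
move=> Hx Hy; elim: Hx => [_ [s <-]||x1 x2 _ IH1 _ IH2].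
- elim: Hy => [_ [t <-]||y1 y2 _ IH1 _ IH2].
  + rewrite -big_cat /=; apply: span_gen; constructor.
    by rewrite sumn_cat PoszD.
  + by rewrite mulr0; apply: span_zero.
  + by rewrite mulrBr; apply: span_sub.
- by rewrite mul0r; apply: span_zero.
- by rewrite mulrBl; apply: span_sub.
Qed.

Lemma st_degree1 : st_degree 0 1.
Proof.
apply: span_gen; have := @SqMonomial 0 [::] erefl.
by rewrite big_nil.
Qed.

Lemma st_degreeSq (i : nat) : st_degree i%:Z (Sq i).
Proof.
apply: span_gen; have := @SqMonomial i%:Z [:: i].
by rewrite big_seq1 /= addn0; apply.
Qed.

Record ringoid := Ringoid {
  robj :> Type;
  rhom : robj -> robj -> zmodType;
  rid : forall a, rhom a a;
  rcomp : forall a b c, rhom b c -> rhom a b -> rhom a c;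
  rcompA : forall a b c d (h : rhom c d) (g : rhom b c) (f : rhom a b),
    rcomp h (rcomp g f) = rcomp (rcomp h g) f;
  rcomp1l : forall a b (f : rhom a b), rcomp (rid b) f = f;
  rcomp1r : forall a b (f : rhom a b), rcomp f (rid a) = f;
  rcompDl : forall a b c (g g' : rhom b c) (f : rhom a b),
    rcomp (g + g') f = rcomp g f + rcomp g' f;
  rcompDr : forall a b c (g : rhom b c) (f f' : rhom a b),
    rcomp g (f + f') = rcomp g f + rcomp g f' }.

Arguments rhom {r} a b.
Arguments rid {r} a.
Arguments rcomp {r a b c} g f.

Section RingoidTheory.
Variable C : ringoid.

Lemma rcomp_is_zmod_morphism a b c (g : @rhom C b c) :
  zmod_morphism (rcomp g : rhom a b -> rhom a c).
Proof.
move=> f f'; apply: (addIr (rcomp g f')).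
by rewrite -rcompDr !subrK.
Qed.

HB.instance Definition _ a b c (g : @rhom C b c) :=
  GRing.isZmodMorphism.Build (rhom a b) (rhom a c) (rcomp g)
    (rcomp_is_zmod_morphism g).

Lemma rcompBr a b c (g : @rhom C b c) (f f' : rhom a b) :
  rcomp g (f - f') = rcomp g f - rcomp g f'.
Proof. exact: raddfB. Qed.

Lemma rcompBl a b c (g g' : @rhom C b c) (f : rhom a b) :
  rcomp (g - g') f = rcomp g f - rcomp g' f.
Proof.
apply: (addIr (rcomp g' f)).
by rewrite -rcompDl !subrK.
Qed.

Lemma rcomp0r a b c (g : @rhom C b c) : rcomp g (0 : rhom a b) = 0.
Proof. exact: raddf0. Qed.

Lemma rcomp0l a b c (f : @rhom C a b) : rcomp (0 : rhom b c) f = 0.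
Proof. by rewrite -[X in rcomp X f](subrr 0) rcompBl subrr. Qed.

End RingoidTheory.

Record ideal (C : ringoid) := Ideal {
  id_sg :> forall a b : C, subgroup (rhom a b);
  id_compl : forall (a b c : C) (g : rhom b c) (f : rhom a b),
    id_sg a b f -> id_sg a c (rcomp g f);
  id_compr : forall (a b c : C) (g : rhom b c) (f : rhom a b),
    id_sg b c g -> id_sg a c (rcomp g f) }.

Section IdealGenerated.
Variables (C : ringoid) (S : forall a b : C, rhom a b -> Prop).

Inductive ideal_span : forall a b : C, rhom a b -> Prop :=
  | is_gen a b (f : rhom a b) : S f -> ideal_span f
  | is_zero a b : ideal_span (0 : rhom a b)
  | is_sub a b (f f' : rhom a b) :
      ideal_span f -> ideal_span f' -> ideal_span (f - f')
  | is_compl a b c (g : rhom b c) (f : rhom a b) :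
      ideal_span f -> ideal_span (rcomp g f)
  | is_compr a b c (g : rhom b c) (f : rhom a b) :
      ideal_span g -> ideal_span (rcomp g f).

Definition ideal_gen : ideal C :=
  @Ideal C (fun a b => Subgroup (is_zero a b) (@is_sub a b)) is_compl is_compr.

End IdealGenerated.

Section QuotientRingoid.
Variables (C : ringoid) (I : ideal C).

Definition qhom (a b : C) : zmodType := quotg (I a b).

Definition qpi (a b : C) (f : rhom a b) : qhom a b := piq (I a b) f.
Lemma qpi_is_zmod_morphism a b : zmod_morphism (@qpi a b).
Proof. exact: piq_is_zmod_morphism. Qed.

HB.instance Definition _ a b :=
  GRing.isZmodMorphism.Build (rhom a b) (qhom a b) (@qpi a b)
    (@qpi_is_zmod_morphism a b).

End QuotientRingoid.

HB.lock Definition qcomp (C : ringoid) (I : ideal C) (a b c : C)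
    (g : qhom I b c) (f : qhom I a b) : qhom I a c :=
  qpi I (rcomp (reprq g) (reprq f)).

Section QuotientRingoidTheory.
Variables (C : ringoid) (I : ideal C).
Local Notation qhom := (qhom I).
Local Notation qpi := (qpi I).

Definition qid (a : C) : qhom a a := qpi (rid a).

Lemma qpi_comp a b c (g : rhom b c) (f : rhom a b) :
  qcomp (qpi g) (qpi f) = qpi (rcomp g f).
Proof.
rewrite qcomp.unlock; apply/piq_eqP; set g' := reprq _; set f' := reprq _.
have -> : rcomp g' f' - rcomp g f = rcomp (g' - g) f' + rcomp g (f' - f).
  by rewrite rcompBl rcompBr addrA subrK.
apply: sgD; first exact/id_compr/repr_piq.
exact/id_compl/repr_piq.
Qed.

Lemma qpiP a b (u : qhom a b) : exists f, u = qpi f.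
Proof. by exists (reprq u); rewrite [RHS]reprqK. Qed.

Lemma qcompA a b c d (h : qhom c d) (g : qhom b c) (f : qhom a b) :
  qcomp h (qcomp g f) = qcomp (qcomp h g) f.
Proof.
have [x ->] := qpiP h; have [y ->] := qpiP g; have [z ->] := qpiP f.
by rewrite !qpi_comp rcompA.
Qed.

Lemma qcomp1l a b (f : qhom a b) : qcomp (qid b) f = f.
Proof. by have [x ->] := qpiP f; rewrite qpi_comp rcomp1l. Qed.

Lemma qcomp1r a b (f : qhom a b) : qcomp f (qid a) = f.
Proof. by have [x ->] := qpiP f; rewrite qpi_comp rcomp1r. Qed.

Lemma qcompDl a b c (g g' : qhom b c) (f : qhom a b) :
  qcomp (g + g') f = qcomp g f + qcomp g' f.
Proof.
have [x ->] := qpiP g; have [y ->] := qpiP g'; have [z ->] := qpiP f.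
by rewrite -raddfD !qpi_comp rcompDl raddfD.
Qed.

Lemma qcompDr a b c (g : qhom b c) (f f' : qhom a b) :
  qcomp g (f + f') = qcomp g f + qcomp g f'.
Proof.
have [x ->] := qpiP g; have [y ->] := qpiP f; have [z ->] := qpiP f'.
by rewrite -raddfD !qpi_comp rcompDr raddfD.
Qed.

Definition quot_ringoid : ringoid :=
  Ringoid qcompA qcomp1l qcomp1r qcompDl qcompDr.

End QuotientRingoidTheory.

Record subringoid (C : ringoid) := Subringoid {
  sr_sg :> forall a b : C, subgroup (rhom a b);
  sr_id : forall a : C, sr_sg a a (rid a);
  sr_comp : forall (a b c : C) (g : rhom b c) (f : rhom a b),
    sr_sg b c g -> sr_sg a b f -> sr_sg a c (rcomp g f) }.

Section SubringoidGenerated.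
Variables (C : ringoid) (S : forall a b : C, rhom a b -> Prop).

Inductive subringoid_span : forall a b : C, rhom a b -> Prop :=
  | ss_gen a b (f : rhom a b) : S f -> subringoid_span f
  | ss_zero a b : subringoid_span (0 : rhom a b)
  | ss_sub a b (f f' : rhom a b) :
      subringoid_span f -> subringoid_span f' -> subringoid_span (f - f')
  | ss_id a : subringoid_span (rid a)
  | ss_comp a b c (g : rhom b c) (f : rhom a b) :
      subringoid_span g -> subringoid_span f -> subringoid_span (rcomp g f).

Definition subringoid_gen : subringoid C :=
  @Subringoid C (fun a b => Subgroup (ss_zero a b) (@ss_sub a b)) ss_id ss_comp.

End SubringoidGenerated.

Section SubringoidAsRingoid.
Variables (C : ringoid) (D : subringoid C).

Definition shom (a b : C) : zmodType := subg (D a b).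

Definition sid (a : C) : shom a a := mk_subg (sr_id D a).
Definition scomp a b c (g : shom b c) (f : shom a b) : shom a c :=
  mk_subg (sr_comp (subgP g) (subgP f)).

Lemma scompA a b c d (h : shom c d) (g : shom b c) (f : shom a b) :
  scomp h (scomp g f) = scomp (scomp h g) f.
Proof. exact/val_inj/rcompA. Qed.

Lemma scomp1l a b (f : shom a b) : scomp (sid b) f = f.
Proof. exact/val_inj/rcomp1l. Qed.

Lemma scomp1r a b (f : shom a b) : scomp f (sid a) = f.
Proof. exact/val_inj/rcomp1r. Qed.

Lemma scompDl a b c (g g' : shom b c) (f : shom a b) :
  scomp (g + g') f = scomp g f + scomp g' f.
Proof. exact/val_inj/rcompDl. Qed.

Lemma scompDr a b c (g : shom b c) (f f' : shom a b) :
  scomp g (f + f') = scomp g f + scomp g f'.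
Proof. exact/val_inj/rcompDr. Qed.

Definition sub_ringoid : ringoid :=
  Ringoid scompA scomp1l scomp1r scompDl scompDr.

End SubringoidAsRingoid.

Lemma additive_sub (U V : zmodType) (f : U -> V) :
  {morph f : x y / x + y} -> zmod_morphism f.
Proof. by move=> fD x y; apply: (addIr (f y)); rewrite -fD !subrK. Qed.

Record lmodule (C : ringoid) := LModule {
  lm_sort :> C -> zmodType;
  lm_act : forall a b : C, rhom a b -> lm_sort a -> lm_sort b;
  lm_actDl : forall a b (f f' : rhom a b) x,
    lm_act (f + f') x = lm_act f x + lm_act f' x;
  lm_actDr : forall a b (f : rhom a b) x y,
    lm_act f (x + y) = lm_act f x + lm_act f y;
  lm_act1 : forall a x, lm_act (rid a) x = x;
  lm_actM : forall a b c (g : rhom b c) (f : rhom a b) x,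
    lm_act (rcomp g f) x = lm_act g (lm_act f x) }.

Arguments lm_act {C} l {a b} f x.

Record lmhom (C : ringoid) (M N : lmodule C) := LMHom {
  lm_map :> forall a : C, M a -> N a;
  lm_mapD : forall a (x y : M a), lm_map (x + y) = lm_map x + lm_map y;
  lm_map_act : forall a b (f : rhom a b) (x : M a),
    lm_map (lm_act M f x) = lm_act N f (lm_map x) }.

Arguments lm_map {C M N} l a x.

HB.instance Definition _ (C : ringoid) (M : lmodule C) a b (f : rhom a b) :=
  GRing.isZmodMorphism.Build (M a) (M b) (lm_act M f)
    (additive_sub (@lm_actDr C M a b f)).

HB.instance Definition _ (C : ringoid) (M N : lmodule C) (f : lmhom M N) a :=
  GRing.isZmodMorphism.Build (M a) (N a) (f a) (additive_sub (@lm_mapD C M N f a)).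

Section Homological.
Variable C : ringoid.
Implicit Types M N P : lmodule C.

Definition lm_surjective M N (f : lmhom M N) : Prop :=
  forall a (y : N a), exists x : M a, f a x = y.

(* Exactness at the middle term: image = kernel, computed objectwise. *)
Definition lm_exact M N P (f : lmhom M N) (g : lmhom N P) : Prop :=
  forall a (y : N a), g a y = 0 <-> exists x : M a, f a x = y.

(* Surjectivity is the same as being an epimorphism of left C-modules. *)
Definition lm_epi M N (f : lmhom M N) : Prop :=
  forall P (u v : lmhom N P),
    (forall a x, u a (f a x) = v a (f a x)) -> forall a y, u a y = v a y.

Section Cokernel.
Variables (M N : lmodule C) (f : lmhom M N).

Definition lm_image (a : C) : subgroup (N a).
Proof.
refine (@Subgroup _ (fun y => exists x, f a x = y) _ _).
- by exists 0; rewrite raddf0.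
- by move=> _ _ [x <-] [y <-]; exists (x - y); rewrite raddfB.
Defined.

Definition coker_act a b (g : rhom a b) (u : quotg (lm_image a)) :
  quotg (lm_image b) := piq (lm_image b) (lm_act N g (reprq u)).

Lemma coker_act_piq a b (g : rhom a b) y :
  coker_act g (piq (lm_image a) y) = piq (lm_image b) (lm_act N g y).
Proof.
apply/piq_eqP; rewrite -raddfB; have [x <-] := @repr_piq _ (lm_image a) y.
by exists (lm_act M g x); rewrite lm_map_act.
Qed.

Definition lm_coker : lmodule C.
Proof.
refine (@LModule C (fun a => quotg (lm_image a)) coker_act _ _ _ _).
- move=> a b g g' x; rewrite -(reprqK x) !coker_act_piq -raddfD.
  by rewrite lm_actDl.
- move=> a b g x y; rewrite -(reprqK x) -(reprqK y) -raddfD !coker_act_piq.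
  by rewrite -raddfD lm_actDr.
- by move=> a x; rewrite -(reprqK x) coker_act_piq lm_act1.
- by move=> a b c g h x; rewrite -(reprqK x) !coker_act_piq lm_actM.
Defined.

Definition coker_proj : lmhom N lm_coker.
Proof.
refine (@LMHom C N lm_coker (fun a => piq (lm_image a)) _ _).
- by move=> a x y; rewrite raddfD.
- by move=> a b g x /=; rewrite coker_act_piq.
Defined.

Definition coker_zero : lmhom N lm_coker.
Proof.
refine (@LMHom C N lm_coker (fun a _ => 0) _ _).
- by move=> a x y; rewrite addr0.
- by move=> a b g x; rewrite raddf0.
Defined.

Lemma lm_epiP : lm_epi f <-> lm_surjective f.
Proof.
split=> [fE a y|fS P u v uv a y]; last by have [x <-] := fS a y.
have E := @fE lm_coker coker_proj coker_zero _ a y.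
have Ey : piq (lm_image a) y = piq (lm_image a) 0.
  rewrite raddf0; apply: E => b x /=.
  rewrite -[RHS](raddf0 (piq (lm_image b))); apply/piq_eqP.
  by exists x; rewrite subr0.
by have /piq_eqP[x fx] := Ey; exists x; rewrite fx subr0.
Qed.

End Cokernel.

Definition lm_zero M : Prop := forall a (x : M a), x = 0.

Definition lm_projective P : Prop :=
  forall M N (p : lmhom M N) (g : lmhom P N), lm_surjective p ->
  exists h : lmhom P M, forall a (x : P a), p a (h a x) = g a x.

(* The complex ... -> P 1 -> P 0 -> M -> 0 is a projective resolution of M of
   length at most n.  It is indexed by all of nat with P i = 0 for i > n, so
   that exactness at P n expresses exactness of 0 -> P n -> ... *)
Definition proj_resolution (n : nat) M (P : nat -> lmodule C)
    (d : forall i, lmhom (P i.+1) (P i)) (e : lmhom (P 0%N) M) : Prop :=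
  [/\ forall i, lm_projective (P i),
      forall i, (n < i)%N -> lm_zero (P i),
      lm_surjective e,
      lm_exact (d 0%N) e
    & forall i, lm_exact (d i.+1) (d i)].

End Homological.

Section SteenrodRingoid.

Definition Ahom (a b : int) : zmodType := subg (st_degree (b - a)).

Lemma Aid_subproof (a : int) : st_degree (a - a) 1.
Proof. by rewrite subrr; apply: st_degree1. Qed.

Definition Aid (a : int) : Ahom a a := mk_subg (Aid_subproof a).

Lemma Acomp_subproof a b c (g : Ahom b c) (f : Ahom a b) :
  st_degree (c - a) (val g * val f).
Proof.
have -> : c - a = (c - b) + (b - a) by rewrite addrA subrK.
by apply: st_degreeM; apply: subgP.
Qed.

Definition Acomp a b c (g : Ahom b c) (f : Ahom a b) : Ahom a c :=
  mk_subg (Acomp_subproof g f).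

Lemma AcompA a b c d (h : Ahom c d) (g : Ahom b c) (f : Ahom a b) :
  Acomp h (Acomp g f) = Acomp (Acomp h g) f.
Proof. exact/val_inj/mulrA. Qed.

Lemma Acomp1l a b (f : Ahom a b) : Acomp (Aid b) f = f.
Proof. exact/val_inj/mul1r. Qed.

Lemma Acomp1r a b (f : Ahom a b) : Acomp f (Aid a) = f.
Proof. exact/val_inj/mulr1. Qed.

Lemma AcompDl a b c (g g' : Ahom b c) (f : Ahom a b) :
  Acomp (g + g') f = Acomp g f + Acomp g' f.
Proof. exact/val_inj/mulrDl. Qed.

Lemma AcompDr a b c (g : Ahom b c) (f f' : Ahom a b) :
  Acomp g (f + f') = Acomp g f + Acomp g f'.
Proof. exact/val_inj/mulrDr. Qed.

Definition Aringoid : ringoid :=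
  Ringoid AcompA Acomp1l Acomp1r AcompDl AcompDr.

Lemma Asq_subproof (n : int) (i : nat) : st_degree (n + i%:Z - n) (Sq i).
Proof. by rewrite addrAC subrr add0r; apply: st_degreeSq. Qed.

Definition Asq (n : int) (i : nat) : @rhom Aringoid n (n + i%:Z) :=
  mk_subg (Asq_subproof n i).

End SteenrodRingoid.

(* The index i = 0 is allowed, so the identity of n is killed for n < 0. *)
Inductive unstable_relator : forall a b : Aringoid, rhom a b -> Prop :=
  | UnstableRelator (n : int) (i : nat) :
      n < i%:Z -> unstable_relator (Asq n i).

Definition unstable_ideal : ideal Aringoid := ideal_gen unstable_relator.

Definition Qringoid : ringoid := quot_ringoid unstable_ideal.

Definition Qsq (n : int) (i : nat) : @rhom Qringoid n (n + i%:Z) :=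
  qpi unstable_ideal (Asq n i).

Inductive Qk_generator (k : nat) : forall a b : Qringoid, rhom a b -> Prop :=
  | QkGenerator (n : int) (i : nat) :
      n - i%:Z < k%:Z -> Qk_generator k (Qsq n i).

Definition Qk_sub (k : nat) : subringoid Qringoid :=
  subringoid_gen (@Qk_generator k).

Definition Qk (k : nat) : ringoid := sub_ringoid (Qk_sub k).

(* Main.v *)
(** Write Sq_l x = Sq^(|x|-l) x.  In this notation the Adem relations rewrite
    Sq_b Sq_a (b > a) as a sum of Sq_c Sq_d with c <= a < d < b, so U_k has the
    operations Sq_0, ..., Sq_(k-1), and N^i, the span of the images of
    Sq_0, ..., Sq_(i-1), is a submodule of N.  Say that N has depth d when Sq_i
    is injective on N/N^i for all i < d.
    - A kernel of a surjection from a module of depth k to a module of depth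
      d < k has depth d + 1.
    - A module of depth k is free: lift a basis of N/N^k and apply the graded
      Nakayama lemma (N vanishes in negative degrees).
    - Free modules have depth k.  Evaluating y in Qk(n, -) on the class x_1...x_r
      of F_2[x_1, ..., x_r], r = n - i, kills exactly the i-th filtration step:
      passing from r to r - 1 takes the coefficient of x_r, and on classes of the
      appropriate degree Sq_i becomes squaring, which is injective.
    Hence the k-th syzygy of any module in a free resolution is itself free. *)
From HB Require Import structures.
From mathcomp Require Import all_boot all_order all_algebra zify ring.
From mathcomp.classical Require Import boolp.
From mathcomp.classical Require classical_sets.
From mathcomp.multinomials Require Import monalg.
Require Import Defs.

Set Implicit Arguments.
Unset Strict Implicit.
Unset Printing Implicit Defensive.

Import Order.TTheory GRing.Theory Num.Theory.
Local Open Scope ring_scope.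

(** * Steenrod operations on polynomial rings *)

(* The coefficient C(b - c - 1, a - 2c) mod 2, with C(-1, j) = 1 for c = b. *)
Definition adem_coef (b a c : nat) : nat :=
  if (2 * c <= a)%N then
    if (c < b)%N then 'C(b - c - 1, a - 2 * c) else c == b
  else 0.

Section AdemRelations.
Variables (V : zmodType) (sq : nat -> V -> V).

(** Any N with a < 2N may bound the sum, since the coefficient vanishes for 2c > a; different
    relations can thus share one index range. *)
Definition adem_at (p : V) : Prop := forall N a b, (a < 2 * N)%N -> (a < 2 * b)%N ->
  sq a (sq b p) = \sum_(c < N) sq (a + b - c) (sq c p) *+ adem_coef b a c.

(* For a = 2b and a = 2b + 1 the extended relation is the tautology
   Sq^a Sq^b = Sq^a Sq^b. *)
Lemma adem_at_ext p : adem_at p -> forall N a b,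
  (a < 2 * N)%N -> (a < 2 * b.+1)%N ->
  sq a (sq b p) = \sum_(c < N) sq (a + b - c) (sq c p) *+ adem_coef b a c.
Proof.
move=> sqA N a b aN ab; have [ab'|ba] := ltnP a (2 * b); first exact: sqA.
have bN : (b < N)%N by lia.
rewrite (bigD1 (Ordinal bN)) //= /adem_coef ba ltnn eqxx addnK mulr1n.
rewrite big1 ?addr0 // => c /eqP cb; have {}cb : c <> b :> nat.
  by move=> E; apply: cb; apply: val_inj.
have /negPf -> : (c : nat) != b by apply/eqP.
case: ifP => // ca; case: ifP => // c_b; rewrite bin_small //; lia.
Qed.

(** These shifts come from Sq^i(px) = Sq^i(p) x + Sq^(i-1)(p) x^2 for x of degree 1; operations of
    negative exponent are 0. *)
Definition psq (i : nat) (p : V) : V := if i is i'.+1 then sq i' p else 0.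
Definition ppsq (i : nat) (p : V) : V := if i is i'.+2 then sq i' p else 0.

Hypothesis sq0 : forall p, sq 0 p = p.
Hypothesis sq_0 : forall i, sq i 0 = 0.
Hypothesis char2 : forall p : V, p *+ 2 = 0.

Lemma mulr_odd (p : V) n : p *+ n = p *+ odd n.
Proof. by rewrite -{1}(odd_double_half n) mulrnDr -muln2 mulnC mulrnA char2 mul0rn addr0. Qed.

(** The x^4 part of the Adem relation for px: shifting c by one turns it into the relation for (a -
    2, b - 1). *)
Lemma adem_shift2 p N a b : adem_at p -> (a < 2 * N)%N -> (a < 2 * b)%N ->
  ppsq a (psq b p) =
  \sum_(c < N) ppsq (a + b - c) (psq c p) *+ adem_coef b a c.
Proof.
case: N => // N; case: b => // b sqA aN ab.
rewrite big_ord_recl /=.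
have ppsq0 i : ppsq i 0 = 0 by case: i => [|[|i]] /=.
rewrite ppsq0 mul0rn add0r.
case: a aN ab => [|[|a]] aN ab; try by rewrite big1 // => c _; rewrite /adem_coef /=;
   case: ifP => // h; exfalso; move: h; rewrite /bump /=; lia.
rewrite /= (sqA N); try lia.
apply: eq_bigr => c _; rewrite /bump /= add1n.
have [ca|ca] := leqP (2 * c) a; last first.
  by rewrite /adem_coef !ifN //; lia.
have -> : (a.+2 + b.+1 - c.+1 = (a + b - c).+2)%N by lia.
by congr (_ *+ _); rewrite /adem_coef ltnS eqSS; do !case: ifP; try lia;
  move=> *; congr 'C(_, _); lia.
Qed.

(** The x^2 part of the Adem relation for px: after reindexing, both sides are sums of Sq^(a+b-1-c)
    Sq^c, and the coefficients agree mod 2 by Pascal's rule. *)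
Lemma adem_shift1 p N a b : adem_at p -> (a < 2 * N)%N -> (a < 2 * b)%N ->
  psq a (sq b p) + sq a (psq b p) =
  \sum_(c < N) (psq (a + b - c) (sq c p) + sq (a + b - c) (psq c p))
                 *+ adem_coef b a c.
Proof.
case: N => // N; case: b => // b sqA aN ab.
case: a aN ab => [|a] aN ab.
  rewrite big_ord_recl /= /adem_coef /= !sq0 !sq_0 add0r addr0 big1 ?addr0 //=.
  by rewrite bin0 mulr1n.
rewrite /= (sqA N.+1); try lia.
(* The exponents are now (a + 1, b), where a + 1 < 2b may fail; only a + 1 < 2(b + 1) is known. *)
rewrite (adem_at_ext (N := N.+1) sqA) //; try lia.
under [RHS]eq_bigr do rewrite mulrnDl.
rewrite -big_split [RHS]big_split /= [X in _ = _ + X]big_ord_recl /= sq_0 mul0rn add0r.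
have -> : \sum_(i < N) sq (a.+1 + b.+1 - bump 0 i) (psq (bump 0 i) p) *+
     adem_coef b.+1 a.+1 (bump 0 i) =
   \sum_(i < N.+1) sq (a.+1 + b - i) (sq i p) *+
     (if (2 * i.+1 <= a.+1)%N then adem_coef b.+1 a.+1 i.+1 else 0).
  rewrite big_ord_recr /= ifN; last lia.
  rewrite mulr0n addr0; apply: eq_bigr => c _.
  rewrite /bump /= add1n addnS subSS; case: ifP => // h.
  by rewrite /adem_coef h.
rewrite -big_split; apply: eq_bigr => /= c _.
have [ca|ca] := leqP (2 * c) a.+1; last first.
  by rewrite /adem_coef !ifN ?addr0 //; lia.
have -> : (a.+1 + b.+1 - c = (a.+1 + b - c).+1)%N by lia.
have -> : (a + b.+1 - c = a.+1 + b - c)%N by lia.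
rewrite -[psq (_).+1 _]/(sq _ _) -!mulrnDr [LHS]mulr_odd [RHS]mulr_odd.
congr (_ *+ nat_of_bool _).
rewrite /adem_coef ca.
have cb : (c <= b)%N by lia.
rewrite [(c < b.+1)%N]ltnS cb [(c.+1 < b.+1)%N]ltnS.
have E1 : (b.+1 - c - 1 = b - c)%N by lia.
have E2 : (b.+1 - c.+1 - 1 = b - c - 1)%N by lia.
have [b_c|b_c] := ltnP c b.
  rewrite E1 E2.
  have -> : (b - c = (b - c - 1).+1)%N by lia.
  set m := (b - c - 1)%N; rewrite subn1 /=.
  case: ifP => c2; case: ifP => c3; rewrite ?c3; try lia.
  - have -> : (a.+1 - 2 * c = (a.+1 - 2 * c.+1).+2)%N by lia.
    have -> : (a - 2 * c = (a.+1 - 2 * c.+1).+1)%N by lia.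
    rewrite !binS; congr odd; lia.
  - have -> : (a.+1 - 2 * c = 1)%N by lia.
    have -> : (a - 2 * c = 0)%N by lia.
    by rewrite !bin0 !bin1; congr odd; lia.
  - have -> : (a.+1 - 2 * c = 0)%N by lia.
    by rewrite !bin0.
(* At c = b the convention C(-1, j) = 1 enters, and the two sides may agree only mod 2. *)
have -> : b = c by lia.
rewrite ?eqxx subSn ?subnn /= ?subnn; last lia.
have [ca'|ca'] := leqP (2 * c) a.
  have -> : (a.+1 - 2 * c = 1)%N by lia.
  have -> : (a - 2 * c = 0)%N by lia.
  by rewrite ifN //; lia.
have -> : (a.+1 - 2 * c = 0)%N by lia.
by rewrite ifN //; lia.
Qed.

End AdemRelations.

(** Taking the total square, the sum of Sq^i(p) t^i, to be a ring morphism encodes the Cartan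
    formula. The carrier is a domain so that the top operation, squaring, is injective. *)
Record sqalg := SqAlg {
  sqcar :> idomainType;
  sqconst : {rmorphism 'F_2 -> sqcar};
  sqtot : {rmorphism sqcar -> {poly sqcar}};
  sqhom : int -> sqcar -> Prop;
  sqtot0 : forall p, (sqtot p)`_0 = p;
  sqtotA : forall p, adem_at (fun i p => (sqtot p)`_i) p;
  sqtot_const : forall c i, (i > 0)%N -> (sqtot (sqconst c))`_i = 0;
  sqhom0 : forall d, sqhom d 0;
  sqhomD : forall d p q, sqhom d p -> sqhom d q -> sqhom d (p + q);
  sqhom_sq : forall d p i, sqhom d p -> sqhom (d + i%:Z) (sqtot p)`_i;
  sqhom_unstable : forall d p i, sqhom d p -> d < i%:Z -> (sqtot p)`_i = 0;
  sqhom_top : forall d p i, sqhom d p -> d = i%:Z -> (sqtot p)`_i = p ^+ 2 }.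

Definition sq (P : sqalg) (i : nat) (p : P) : P := (sqtot P p)`_i.

Section SqAlgTheory.
Variable P : sqalg.

Lemma sq_is_zmod_morphism i : zmod_morphism (@sq P i).
Proof. by move=> p q; rewrite /sq raddfB coefB. Qed.

HB.instance Definition _ i :=
  GRing.isZmodMorphism.Build P P (@sq P i) (sq_is_zmod_morphism i).

Lemma sqalg_char2 (p : P) : p *+ 2 = 0.
Proof.
rewrite -mulr_natl -(rmorph_nat (sqconst P)).
by have -> : 2%:R = 0 :> 'F_2; [exact/val_inj | rewrite rmorph0 mul0r].
Qed.

Lemma poly_char2 (p : {poly P}) : p *+ 2 = 0.
Proof. by apply/polyP => i; rewrite coefMn coef0 sqalg_char2. Qed.

(* The total square of the variable x is x + t x^2. *)
Definition step_var : {poly {poly P}} := 'X%:P + ('X^2)%:P * 'X.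

Lemma step_comm :
  commr_rmorph (map_poly (@polyC P) \o sqtot P : P -> {poly {poly P}}) step_var.
Proof. by move=> p; apply: mulrC. Qed.

Definition step_tot : {poly P} -> {poly {poly P}} := horner_morph step_comm.
HB.instance Definition _ := GRing.RMorphism.on step_tot.

Local Notation ssq i p := ((step_tot p)`_i).

Lemma step_totC c i : ssq i c%:P = (sq i c)%:P.
Proof. by rewrite /step_tot horner_morphC /= coef_map. Qed.

Lemma step_totX p i : ssq i (p * 'X) =
  ssq i p * 'X + psq (fun i p => ssq i p) i p * 'X^2.
Proof.
rewrite /step_tot rmorphM /= horner_morphX /step_var mulrDr coefD coefMC.
by rewrite mulrA coefMX coefMC; case: i => [|i] //=; rewrite mul0r.
Qed.

Inductive step_hom : int -> {poly P} -> Prop :=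
| StepHomC d c : sqhom d c -> step_hom d c%:P
| StepHomX d p : step_hom d p -> step_hom (d + 1) (p * 'X)
| StepHomD d p q : step_hom d p -> step_hom d q -> step_hom d (p + q).

Lemma step_tot0 p : ssq 0 p = p.
Proof.
elim/poly_ind: p => [|p c IH]; first by rewrite rmorph0 coef0.
by rewrite rmorphD coefD step_totX step_totC IH /= mul0r addr0 /sq sqtot0.
Qed.

Lemma step_totXX p i : ssq i (p * 'X^2) =
  ssq i p * 'X^2 + ppsq (fun i p => ssq i p) i p * 'X^4.
Proof.
rewrite [in LHS]expr2 mulrA !step_totX; case: i => [|i] /=.
  by rewrite !mul0r !addr0 -mulrA.
rewrite step_totX; set a := ssq i p; set b := psq _ i p.
transitivity (ssq i.+1 p * 'X^2 + (a * 'X^3) *+ 2 + b * 'X^4); first by ring.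
by rewrite poly_char2 addr0; congr (_ + _ * _).
Qed.

(** Induction on the polynomial: Sq^a Sq^b (px) splits into multiples of x, x^2 and x^4, which are
    handled by the induction hypothesis, [adem_shift1] and [adem_shift2]. *)
Lemma step_totA p : adem_at (fun i p => ssq i p) p.
Proof.
have ssqD i : {morph (fun p => ssq i p) : p q / p + q}.
  by move=> x y; rewrite rmorphD coefD.
have ssq0 i : ssq i 0 = 0 by rewrite rmorph0 coef0.
elim/poly_ind: p => [|p c IH] N a b aN ab.
  by rewrite !ssq0 big1 // => i _; rewrite !ssq0 mul0rn.
rewrite !ssqD; under eq_bigr do rewrite !ssqD mulrnDl.
rewrite big_split /=; congr (_ + _); last first.
  rewrite !step_totC [sq a _](sqtotA c aN ab) raddf_sum; apply: eq_bigr => i _ /=.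
  by rewrite raddfMn !step_totC.
have E i j : ssq i (ssq j (p * 'X)) = ssq i (ssq j p) * 'X
  + (psq (fun i p => ssq i p) i (ssq j p) + ssq i (psq (fun i p => ssq i p) j p)) * 'X^2
  + ppsq (fun i p => ssq i p) i (psq (fun i p => ssq i p) j p) * 'X^4.
  rewrite step_totX ssqD step_totX step_totXX !mulrDl -!addrA.
  by congr (_ + _); rewrite !mulrA -!expr2.
rewrite E [ssq a (ssq b p)](IH _ _ _ aN ab) (adem_shift1 step_tot0 ssq0 poly_char2 IH aN ab).
rewrite (adem_shift2 ssq0 IH aN ab).
rewrite !mulr_suml -!big_split; apply: eq_bigr => i _ /=.
by rewrite E [RHS]mulrnDl [X in _ = X + _]mulrnDl !mulrnAl.
Qed.

Lemma step_tot_const c i : (i > 0)%N -> ssq i (sqconst P c)%:P = 0.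
Proof. by move=> i0; rewrite step_totC /sq sqtot_const. Qed.

Lemma step_hom_sq d p i : step_hom d p -> step_hom (d + i%:Z) (ssq i p).
Proof.
move=> dp; elim: dp i => {d p} [d c dc i|d p dp IH i|d p q _ IHp _ IHq i].
- by rewrite step_totC; apply/StepHomC/sqhom_sq.
- rewrite step_totX; apply: StepHomD; first by rewrite addrAC; apply: StepHomX.
  case: i => [|i] /=.
    by rewrite mul0r -(polyC0 P); apply/StepHomC/sqhom0.
  rewrite expr2 mulrA; have -> : d + 1 + i.+1%:Z = d + i%:Z + 1 + 1 by lia.
  by do 2!apply: StepHomX; apply: IH.
- by rewrite rmorphD coefD; apply: StepHomD.
Qed.

Lemma step_hom_unstable d p i : step_hom d p -> d < i%:Z -> ssq i p = 0.
Proof.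
move=> dp; elim: dp i => {d p} [d c dc i di|d p dp IH i di|d p q _ IHp _ IHq i di].
- by rewrite step_totC [sq _ _](sqhom_unstable dc) ?polyC0.
- rewrite step_totX IH; last by lia.
  by case: i di => [|i] di /=; rewrite ?IH ?mul0r ?addr0 //; lia.
- by rewrite rmorphD coefD IHp // IHq // addr0.
Qed.

Lemma step_hom_top d p i : step_hom d p -> d = i%:Z -> ssq i p = p ^+ 2.
Proof.
move=> dp; elim: dp i => {d p} [d c dc i di|d p dp IH i di|d p q _ IHp _ IHq i di].
- by rewrite step_totC [sq _ _](sqhom_top dc) // rmorphXn.
- rewrite step_totX (step_hom_unstable dp) ?mul0r ?add0r; last by lia.
  case: i di => [|i] di /=; last by rewrite IH ?exprMn //; lia.
  (* Here i = 0 and p has degree -1, so p = Sq^0 p vanishes by instability. *)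
  have -> : p = 0; last by rewrite !mul0r expr0n.
  by rewrite -[p]step_tot0 (step_hom_unstable dp) //; lia.
- rewrite rmorphD coefD IHp // IHq // sqrrD -mulr_natr.
  by rewrite mulr_natr poly_char2 addr0.
Qed.

Definition sqalg_step : sqalg.
Proof.
refine (@SqAlg {poly P} (polyC \o sqconst P) step_tot step_hom _ _ _ _ _ _ _ _).
- exact: step_tot0.
- exact: step_totA.
- exact: step_tot_const.
- by move=> d; rewrite -(polyC0 P); apply/StepHomC/sqhom0.
- exact: StepHomD.
- by move=> d p i; apply: step_hom_sq.
- by move=> d p i; apply: step_hom_unstable.
- by move=> d p i; apply: step_hom_top.
Defined.

End SqAlgTheory.

(** * The ground field and the polynomial rings in r variables of degree 1 *)

Lemma coef_const_pos (c : 'F_2) i : (i > 0)%N -> (c%:P)`_i = 0.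
Proof. by rewrite coefC; case: i. Qed.

Lemma F2_totA (p : 'F_2) : adem_at (fun i (p : 'F_2) => (p%:P)`_i) p.
Proof.
move=> N a b aN ab.
rewrite [p%:P`_b]coef_const_pos ?polyC0 ?coef0 ?big1 //; last by lia.
move=> [[|c] /= cN] _; last by rewrite [p%:P`_c.+1]coef_const_pos // polyC0 coef0 mul0rn.
by rewrite coef_const_pos ?mul0rn //; lia.
Qed.

Definition F2_hom (d : int) (c : 'F_2) : Prop := d = 0 \/ c = 0.

Definition sqalg_F2 : sqalg.
Proof.
refine (@SqAlg 'F_2 idfun polyC F2_hom _ F2_totA coef_const_pos _ _ _ _ _).
- by move=> p; rewrite coefC.
- by right.
- by move=> d p q [->|->]; [left | rewrite add0r].
- move=> d p [|i] [->|->]; rewrite ?coef0; try by right.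
    by left.
  by rewrite coef_const_pos //; right.
- move=> d p [|i] [->|->] //; rewrite ?coef0 //.
  by rewrite coef_const_pos.
- move=> d p i [->|->]; last by rewrite coef0 expr0n.
  case: i => // _; rewrite coefC /=.
  by apply/val_inj; case: p => [[|[|]]].
Defined.

Fixpoint sqalg_poly (r : nat) : sqalg :=
  if r is r'.+1 then sqalg_step (sqalg_poly r') else sqalg_F2.

Fixpoint var_prod (r : nat) : sqalg_poly r :=
  match r return sqalg_poly r with
  | 0 => 1 : sqalg_F2
  | r'.+1 => (var_prod r')%:P * 'X : sqalg_step (sqalg_poly r')
  end.

Lemma var_prod_neq0 r : var_prod r != 0.
Proof.
elim: r => [|r IH]; first exact: oner_neq0.
by rewrite /= mulf_neq0 ?polyX_eq0 // polyC_eq0.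
Qed.

Lemma var_prod_hom r : sqhom r%:Z (var_prod r).
Proof.
elim: r => [|r IH]; first exact: or_introl.
have -> : r.+1%:Z = r%:Z + 1 by lia.
change (step_hom (r%:Z + 1) ((var_prod r)%:P * 'X)).
by apply: StepHomX; apply: StepHomC.
Qed.

(* So the coefficient of x_(r+1) is a map of degree -1 commuting with Sq^i: it
   realises the suspension. *)
Lemma sq_linear_part r i (c : sqalg_poly r) (h : {poly sqalg_poly r}) :
  exists h', @sq (sqalg_poly r.+1) i (c%:P * 'X + h * 'X^2 : {poly sqalg_poly r}) =
    (sq i c)%:P * 'X + h' * 'X^2 :> {poly sqalg_poly r}.
Proof.
set s := psq (fun i p => (step_tot p)`_i) i c%:P.
exists (s + (step_tot h)`_i
   + ppsq (fun i p => (step_tot p)`_i) i h * 'X^2).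
rewrite /sq /= rmorphD coefD step_totX step_totXX step_totC.
rewrite !mulrDl -!addrA; congr (_ + (_ + (_ + _))).
by rewrite -mulrA -exprD.
Qed.

(** * The action of the Steenrod algebra *)

Section SteenrodAction.
Variable P : sqalg.

Definition sqword (s : seq nat) (p : P) : P := foldr (@sq P) p s.

Lemma sqword_sum s (I : Type) (r : seq I) (F : I -> P) :
  sqword s (\sum_(i <- r) F i) = \sum_(i <- r) sqword s (F i).
Proof. by elim: s => //= i s ->; rewrite raddf_sum. Qed.

Definition free_act (p : P) (a : freeSq) : P :=
  mmap (sqconst P) (fun m : {fmonom nat} => sqword m p) a.

Lemma free_act_is_zmod_morphism p : zmod_morphism (free_act p).
Proof. by move=> a b; rewrite /free_act raddfB. Qed.

HB.instance Definition _ p := GRing.isZmodMorphism.Build freeSq P (free_act p)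
  (free_act_is_zmod_morphism p).

Lemma free_actB a b p : free_act p (a - b) = free_act p a - free_act p b.
Proof. exact: (raddfB (free_act p)). Qed.

Lemma free_actU c m p :
  free_act p << c *g m >> = sqconst P c * sqword m p.
Proof. exact: mmapU. Qed.

Lemma sqwordB s p q : sqword s (p - q) = sqword s p - sqword s q.
Proof. by elim: s => //= i s ->; rewrite raddfB. Qed.

Lemma sqwordZ s c p : sqword s (sqconst P c * p) = sqconst P c * sqword s p.
Proof.
(* A scalar in F_2 is 0 or 1, so additivity already gives linearity. *)
have [->|->] : c = 0 \/ c = 1.
  by case: c => [[|[|]]] // ?; [left | right]; apply: val_inj.
- rewrite !rmorph0 !mul0r; elim: s => //= i s ->; exact: raddf0.
- by rewrite !rmorph1 !mul1r.
Qed.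

Lemma free_actBr a p q : free_act (p - q) a = free_act p a - free_act q a.
Proof.
rewrite /free_act /mmap -sumrB; apply: eq_bigr => m _.
by rewrite sqwordB mulrBr.
Qed.

Lemma free_act0r a : free_act 0 a = 0.
Proof. by have := free_actBr a 0 0; rewrite !subrr. Qed.

Lemma free_actM a b p : free_act p (a * b) = free_act (free_act p b) a.
Proof.
rewrite {1}/free_act /= [_ * _](malgME a b) raddf_sum [RHS]/free_act /mmap /=.
apply: eq_bigr => m _; rewrite raddf_sum sqword_sum.
rewrite mulr_sumr; apply: eq_bigr => n _.
rewrite [LHS]mmapU sqwordZ fmM [X in X * _ = _](rmorphM (sqconst P)) -mulrA.
congr (_ * (_ * _)).
by rewrite /sqword foldr_cat.
Qed.

Lemma free_act1 p : free_act p 1 = p.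
Proof.
have -> : (1 : freeSq) = mkmalgU (mone : {fmonom nat}) (1 : 'F_2) by [].
rewrite free_actU.
by rewrite rmorph1 mul1r fm1.
Qed.

Lemma free_act_letter i p : free_act p (letter i) = sq i p.
Proof. by rewrite free_actU rmorph1 mul1r fmU. Qed.

Lemma free_act_adem r p : adem_relator r -> free_act p r = 0.
Proof.
case=> [|a b /andP[a0 ab]].
  by rewrite free_actB free_act_letter free_act1 /sq sqtot0 subrr.
rewrite free_actB free_actM !free_act_letter.
rewrite [sq a _](@sqtotA P p (a %/ 2).+1); try lia.
rewrite (raddf_sum (free_act p)) big_mkord -sumrB big1 // => c _.
rewrite mulr_natl (raddfMn (free_act p)) /= free_actM !free_act_letter.
have ca : (2 * c <= a)%N.
  by have := ltn_ord c; rewrite ltnS => h; rewrite mulnC -leq_divRL.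
by rewrite /adem_coef ca ifT ?subrr //; lia.
Qed.

Lemma free_act_two_sided r p : two_sided adem_relator r -> free_act p r = 0.
Proof.
elim=> [_ [x s y Ss]||x y _ IHx _ IHy].
- by rewrite !free_actM (free_act_adem _ Ss) free_act0r.
- exact: (raddf0 (free_act p)).
- by rewrite free_actB IHx IHy subrr.
Qed.

(** The chosen representative does not matter, because the Adem ideal acts by zero
    ([free_act_two_sided]). *)
Definition st_act (u : steenrod) (p : P) : P := free_act p (reprq u).

Lemma st_act_pir a p : st_act (pir adem_relator a) p = free_act p a.
Proof.
apply/eqP; rewrite -subr_eq0 /st_act -free_actB.
by apply/eqP/free_act_two_sided/repr_piq.
Qed.

Lemma st_actB u v p : st_act (u - v) p = st_act u p - st_act v p.
Proof.
have [a ->] := pirP u; have [b ->] := pirP v.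
by rewrite -raddfB !st_act_pir free_actB.
Qed.

Lemma st_act0 p : st_act 0 p = 0.
Proof. by have := st_actB 0 0 p; rewrite !subrr. Qed.

Lemma st_actM u v p : st_act (u * v) p = st_act u (st_act v p).
Proof.
have [a ->] := pirP u; have [b ->] := pirP v.
by rewrite -[_ * _](rmorphM (pir adem_relator)) !st_act_pir free_actM.
Qed.

Lemma st_act1 p : st_act 1 p = p.
Proof. by rewrite -[1](rmorph1 (pir adem_relator)) st_act_pir free_act1. Qed.

Lemma st_act_Sq i p : st_act (Sq i) p = sq i p.
Proof. by rewrite st_act_pir free_act_letter. Qed.

Lemma st_act_hom d n u p :
  st_degree n u -> sqhom d p -> sqhom (d + n) (st_act u p).
Proof.
move=> un dp; have hB e x y : @sqhom P e x -> sqhom e y -> sqhom e (x - y).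
  move=> hx hy; have -> : x - y = x + y; last exact: sqhomD.
  by congr (_ + _); apply/eqP; rewrite eq_sym -subr_eq0 opprK -mulr2n sqalg_char2.
elim: un => [_ [s <-]||x y _ IHx _ IHy].
- elim: s => [|i s IH] /=; first by rewrite big_nil st_act1 addr0.
  rewrite big_cons st_actM st_act_Sq PoszD [X in _ + X]addrC addrA.
  exact: sqhom_sq.
- by rewrite st_act0; apply: sqhom0.
- by rewrite st_actB; apply: hB.
Qed.

(** Sq^i with a < i kills every class of degree at most a, and composing with f raises d and a
    equally, so d <= a suffices. Evaluation at x_1...x_r is thereby well defined on morphisms with
    source n >= r. *)
Lemma st_act_unstable a b (h : @rhom Aringoid a b) d p :
  unstable_ideal a b h -> sqhom d p -> d <= a -> st_act (val h) p = 0.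
Proof.
move=> hI; elim: hI d p => {a b h}.
- move=> a b f [n i ni] d p dp dn /=.
  by rewrite st_act_Sq [sq _ _](sqhom_unstable dp) //; lia.
- by move=> a b d p _ _; apply: st_act0.
- by move=> a b f f' _ IH _ IH' d p dp da; rewrite st_actB (IH d) // (IH' d) ?subrr.
- move=> a b c g f _ IH d p dp da.
  by rewrite /= st_actM (IH d) //; apply: free_act0r.
- move=> a b c g f _ IH d p dp da /=.
  rewrite st_actM (IH _ _ (st_act_hom (subgP f) dp)) //; lia.
Qed.

End SteenrodAction.

Lemma st_act_linear_part r n u (c : sqalg_poly r) : st_degree n u ->
  exists h', @st_act (sqalg_poly r.+1) u (c%:P * 'X : {poly sqalg_poly r}) =
    (st_act u c)%:P * 'X + h' * 'X^2 :> {poly sqalg_poly r}.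
Proof.
elim=> [_ [s _]||x y _ [h hE] _ [h' hE']].
- elim: s => [|i s [h IH]].
    by rewrite big_nil !st_act1; exists 0; rewrite mul0r addr0.
  by rewrite big_cons !st_actM IH !st_act_Sq; apply: sq_linear_part.
- by exists 0; rewrite !st_act0 polyC0 !mul0r addr0.
- exists (h - h'); rewrite !st_actB hE hE' polyCB !mulrBl.
  by rewrite opprD addrACA.
Qed.

(** The value of u on x_1...x_r is the coefficient of x_(r+1) in its value on x_1...x_(r+1). *)
Lemma st_act_var_prod r n u : st_degree n u ->
  st_act u (var_prod r.+1) = 0 -> st_act u (var_prod r) = 0.
Proof.
move=> un; have [h /= ->] := st_act_linear_part (var_prod r) un.
move/(congr1 (fun p : {poly sqalg_poly r} => p`_1)) => /eqP.
by rewrite coefD coefMX coefMXn coefC addr0 coef0 => /eqP.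
Qed.

(** * Filtration and depth of modules *)

Section Representatives.
Variable k : nat.
Implicit Types a b c : int.

(** This relation avoids transport between hom groups whose endpoints are only provably equal:
    identities are computed on u, and [rep_inj] brings them back. *)
Definition rep a b (f : @rhom (Qk k) a b) (u : steenrod) : Prop :=
  exists h : Ahom a b, val h = u /\ val f = qpi unstable_ideal h.

Lemma rep_inj a b (f g : @rhom (Qk k) a b) u : rep f u -> rep g u -> f = g.
Proof.
move=> [h [hu fh]] [h' [h'u gh']]; apply: val_inj; rewrite fh gh'.
by congr qpi; apply: val_inj; rewrite hu h'u.
Qed.

Lemma repB a b (f g : @rhom (Qk k) a b) u v :
  rep f u -> rep g v -> rep (f - g) (u - v).
Proof.
move=> [h [<- fh]] [h' [<- gh]]; exists (h - h'); split; first by rewrite raddfB.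
transitivity (val f - val g); first exact: (raddfB (val : shom (Qk_sub k) a b -> _)).
by rewrite fh gh; apply/esym; exact: (raddfB (@qpi _ unstable_ideal a b)).
Qed.

Lemma rep0 a b : rep (0 : @rhom (Qk k) a b) 0.
Proof. by exists 0; split; rewrite ?raddf0. Qed.

Lemma repMn a b (f : @rhom (Qk k) a b) u n : rep f u -> rep (f *+ n) (u *+ n).
Proof.
move=> fu; elim: n => [|n IH]; first exact: rep0.
rewrite !mulrS -[f *+ n]opprK -[u *+ n]opprK; apply: repB => //.
by rewrite -[- (f *+ n)]sub0r -[- (u *+ n)]sub0r; apply: repB => //; apply: rep0.
Qed.

Lemma rep_comp a b c (g : @rhom (Qk k) b c) (f : @rhom (Qk k) a b) u v :
  rep g u -> rep f v -> rep (rcomp g f) (u * v).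
Proof.
move=> [h [<- gh]] [h' [<- fh]]; exists (Acomp h h'); split => //.
transitivity (@rcomp Qringoid _ _ _ (val g) (val f)); first by [].
by rewrite gh fh; apply: (@qpi_comp Aringoid unstable_ideal).
Qed.

Lemma rep_id a : rep (@rid (Qk k) a) 1.
Proof. by exists (Aid a). Qed.

Lemma rep_ex a b (f : @rhom (Qk k) a b) : exists2 u, rep f u & st_degree (b - a) u.
Proof.
have [h fh] := @qpiP Aringoid unstable_ideal a b (val f); exists (val h); first by exists h.
exact: subgP.
Qed.

Lemma rep_gen a b (j : nat) : a + j%:Z = b -> a - j%:Z < k%:Z ->
  exists f : @rhom (Qk k) a b, rep f (Sq j).
Proof.
move=> <- ajk; have jk := ss_gen (QkGenerator ajk).
by exists (@mk_subg _ (Qk_sub k _ _) _ jk); exists (Asq a j).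
Qed.

Lemma rep_unstable a b (f : @rhom (Qk k) a b) (j : nat) :
  a + j%:Z = b -> a < j%:Z -> rep f (Sq j) -> f = 0.
Proof.
move=> E aj [h [hu fh]]; apply: val_inj; rewrite raddf0 fh /=.
move: E f h hu {fh} => <- f h hu; have -> : h = Asq a j by apply: val_inj.
rewrite -(raddf0 (@qpi _ unstable_ideal a (a + j%:Z))).
by apply/piq_eqP; rewrite subr0; apply/is_gen/UnstableRelator.
Qed.

Lemma rep_st_act a b (f : @rhom (Qk k) a b) u v (P : sqalg) d (p : P) :
  rep f u -> rep f v -> sqhom d p -> d <= a -> st_act u p = st_act v p.
Proof.
move=> [h [<- fh]] [h' [<- fh']] dp da.
apply/eqP; rewrite -subr_eq0 -st_actB; apply/eqP.
have /piq_eqP hI : qpi unstable_ideal h = qpi unstable_ideal h' by rewrite -fh.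
by have := st_act_unstable hI dp da; rewrite raddfB.
Qed.

Lemma rep_ind (X : forall a b : int, @rhom (Qk k) a b -> Prop) :
  (forall a b j f, a + j%:Z = b -> a - j%:Z < k%:Z -> rep f (Sq j) -> X a b f) ->
  (forall a b, X a b 0) ->
  (forall a, X a a (@rid (Qk k) a)) ->
  (forall a b f g, X a b f -> X a b g -> X a b (f - g)) ->
  (forall a b c f g, X a b f -> X b c g -> X a c (@rcomp (Qk k) a b c g f)) ->
  forall a b f, X a b f.
Proof.
move=> Xgen X0 X1 XB Xcomp a b f.
suff: forall c d (g : @rhom Qringoid c d), subringoid_span (@Qk_generator k) g ->
    forall f : @rhom (Qk k) c d, val f = g -> X c d f.
  by move=> H; apply: H (subgP f) _ erefl.
move=> c d g; elim=> {a b f c d g}.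
- move=> a b f [n i nik] g gE; apply: (Xgen _ _ i) => //.
  by exists (Asq n i).
- by move=> a b f fE; have -> : f = 0; [apply: val_inj; rewrite fE raddf0|].
- move=> a b g g' Sg IH Sg' IH' f fE.
  have -> : f = @mk_subg _ (Qk_sub k a b) _ Sg - @mk_subg _ (Qk_sub k a b) _ Sg'.
    by apply: val_inj; rewrite fE [RHS](raddfB (val : shom (Qk_sub k) a b -> _)).
  by apply: XB; [apply: IH | apply: IH'].
- move=> a f fE; have -> : f = @rid (Qk k) a; [exact: val_inj|exact: X1].
- move=> a b c g g' Sg IH Sg' IH' f fE.
  have -> : f = @rcomp (Qk k) _ _ _ (@mk_subg _ (Qk_sub k b c) _ Sg)
                      (@mk_subg _ (Qk_sub k a b) _ Sg').
    exact: val_inj.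
  by apply: Xcomp; [apply: IH' | apply: IH].
Qed.

End Representatives.

Lemma subrBB (V : zmodType) (a b c d : V) : a - b - (c - d) = (a - c) - (b - d).
Proof. by rewrite !opprB addrACA [RHS]addrACA [- b - _]addrC. Qed.

Lemma steenrod_char2 (u : steenrod) : u *+ 2 = 0.
Proof.
have E : (1 : freeSq) *+ 2 = 0.
  have -> : (1 : freeSq) = mkmalgU (mone : {fmonom nat}) (1 : 'F_2) by [].
  rewrite -[LHS]monalgUMn; have -> : (1 : 'F_2) *+ 2 = 0 by apply: val_inj.
  exact: monalgU0.
have [a ->] := pirP u; rewrite -raddfMn -[a]mulr1 -mulrnAr E mulr0.
exact: raddf0.
Qed.

Lemma adem_relation a b : (0 < a < 2 * b)%N ->
  Sq a * Sq b = \sum_(0 <= c < (a %/ 2).+1)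
    (Sq (a + b - c) * Sq c) *+ 'C(b - c - 1, a - 2 * c).
Proof.
move=> ab; have E := two_sided_gen (adem_prod ab).
rewrite -[LHS](rmorphM (pir adem_relator)).
rewrite [LHS](iffRL (piq_eqP (two_sided adem_relator) _ _) E) [LHS](raddf_sum (pir adem_relator)).
apply: eq_bigr => c _.
by rewrite mulr_natl [LHS]raddfMn [X in X *+ _](rmorphM (pir adem_relator)).
Qed.

(** * The filtration by lower-indexed squares *)

Section Filtration.
Variables (k : nat) (N : lmodule (Qk k)).
Implicit Types a b m : int.

Lemma lm_act0 a m (x : N a) : lm_act N (0 : @rhom (Qk k) a m) x = 0.
Proof.
have := lm_actDl 0 (0 : @rhom (Qk k) a m) x.
by rewrite addr0 -[X in X = _]addr0 => /addrI.
Qed.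

Lemma lm_actBl a m (f g : @rhom (Qk k) a m) (x : N a) :
  lm_act N (f - g) x = lm_act N f x - lm_act N g x.
Proof. by apply/eqP; rewrite eq_sym subr_eq -lm_actDl subrK. Qed.

Lemma lm_actBr a m (f : @rhom (Qk k) a m) (x y : N a) :
  lm_act N f (x - y) = lm_act N f x - lm_act N f y.
Proof. exact: raddfB. Qed.

Lemma lm_neg m (x : N m) : m < 0 -> x = 0.
Proof.
move=> m0; rewrite -[x]lm_act1.
have -> : @rid (Qk k) m = 0.
  apply: (@rep_unstable _ _ _ _ 0); rewrite ?addr0 ?Sq0 //; exact: rep_id.
exact: lm_act0.
Qed.

(** With l = a - j, the operation Sq^j on degree a is Sq_l. The condition 0 < j excludes the
    identities Sq^0 and makes [nakayama] possible. *)
Definition gen_im (i : nat) (m : int) (x : N m) : Prop :=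
  exists a (j : nat) (f : @rhom (Qk k) a m) (g : N a),
    [/\ a + j%:Z = m, (0 < j)%N, a - j%:Z < i%:Z, rep f (Sq j) & x = lm_act N f g].

(* N^i of the header. *)
Definition fil (i : nat) (m : int) : subgroup (N m) := spang (@gen_im i m).

Lemma fil_gen i a m (j : nat) (f : @rhom (Qk k) a m) (g : N a) :
  a + j%:Z = m -> (0 < j)%N -> a - j%:Z < i%:Z -> rep f (Sq j) ->
  fil i m (lm_act N f g).
Proof. by move=> *; apply: span_gen; exists a, j, f, g. Qed.

Lemma fil_mono i i' m (x : N m) : (i <= i')%N -> fil i m x -> fil i' m x.
Proof.
move=> ii; elim=> [_ [a [j [f [g [am j0 aj fj ->]]]]]||y z _ IHy _ IHz].
- by apply: fil_gen fj => //; lia.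
- exact: (sg0 (fil _ _)).
- exact: sgB.
Qed.

(** On Sq^b' g with g of degree b: if j >= 2b', then Sq^j has lower index b + b' - j <= b - b' < i
    already. Otherwise the Adem relation gives terms Sq^(j+b'-c) Sq^c g with outer lower index b -
    b' + 2c - j <= b - b' < i. *)
Lemma fil_Sq i a m (j : nat) (f : @rhom (Qk k) a m) (x : N a) :
  (i <= k)%N -> a + j%:Z = m -> a - j%:Z < k%:Z -> rep f (Sq j) ->
  fil i a x -> fil i m (lm_act N f x).
Proof.
move=> ik am ajk fj; elim=> [_ [b [b' [f' [g [ba b0 bb f'b ->]]]]]||y z _ IHy _ IHz].
- have [j0|j0] := posnP j.
    move: am f fj; rewrite j0 addr0 => am; case: m / am => f fj.
    rewrite (_ : f = @rid (Qk k) a) ?lm_act1; first exact: fil_gen f'b.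
    by apply: rep_inj fj _; rewrite Sq0; apply: rep_id.
  have [jb|jb] := leqP (2 * b') j; first by apply: fil_gen fj => //; lia.
  rewrite -lm_actM.
  suff [h [hu hfil]] : exists h : @rhom (Qk k) b m,
      rep h (Sq j * Sq b') /\ forall g, fil i m (lm_act N h g).
    by rewrite (rep_inj (rep_comp fj f'b) hu).
  have jb' : (0 < j < 2 * b')%N by lia.
  rewrite (adem_relation jb') big_mkord.
  apply: (big_ind (fun u => exists h : @rhom (Qk k) b m,
      rep h u /\ forall g, fil i m (lm_act N h g))).
  + by exists 0; split=> [|h]; [exact: rep0 | rewrite lm_act0; exact: (sg0 (fil _ _))].
  + move=> u v [h [hu hf]] [h' [h'v h'f]]; exists (h - (0 - h')).
    rewrite -[v]opprK -[- v]sub0r; split; first by do 2?[apply: repB => //; try exact: rep0].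
    move=> y; rewrite lm_actBl lm_actBl lm_act0.
    by do 2?[apply: sgB; try exact: (sg0 (fil _ _))].
  + move=> [c /= cj] _; have [C0|C0] := posnP 'C(b' - c - 1, j - 2 * c).
      exists 0; rewrite C0 mulr0n; split=> [|y]; first exact: rep0.
      by rewrite lm_act0; apply: (sg0 (fil _ _)).
    (* A nonzero binomial forces c > j - b', so Sq^c on degree b has lower index b - c < a - j < k
       and lies in [Qk]. *)
    move: C0; rewrite bin_gt0 => C0.
    have cj2 : (2 * c <= j)%N by lia.
    have [h1 h1c] : exists h1 : @rhom (Qk k) b (b + c%:Z), rep h1 (Sq c).
      by apply: rep_gen => //; lia.
    have [h2 h2c] : exists h2 : @rhom (Qk k) (b + c%:Z) m, rep h2 (Sq (j + b' - c)).
      by apply: rep_gen => //; lia.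
    exists (@rcomp (Qk k) _ _ _ h2 h1 *+ 'C(b' - c - 1, j - 2 * c)); split.
      exact/repMn/rep_comp.
    move=> y; elim: 'C(_, _) => [|n IH]; first by rewrite lm_act0; apply: (sg0 (fil _ _)).
    rewrite mulrS lm_actDl; apply: (@sgD _ (fil i m)); last exact: IH.
    rewrite lm_actM.
    by apply: fil_gen h2c; lia.
- by rewrite raddf0; apply: (sg0 (fil _ _)).
- by rewrite lm_actBr; apply: sgB.
Qed.

(** Induction on the degree: since 0 < j, every generator of the filtration comes from a strictly
    lower degree, and negative degrees vanish. *)
Lemma nakayama : (forall m (x : N m), fil k m x) -> forall m (x : N m), x = 0.
Proof.
move=> Nk m x; have [n mn] : exists n : nat, m < n%:Z by exists `|m|.+1%N; lia.
elim: n m x mn => [|n IH] m x mn; first by apply: lm_neg; lia.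
elim: (Nk m x) => [_ [a [j [f [g [am j0 aj fj ->]]]]]||y z _ -> _ ->].
- by rewrite (IH a g) ?raddf0 //; lia.
- by [].
- by rewrite subrr.
Qed.

(* "Sq_0, ..., Sq_(d-1) is a regular sequence on N". *)
Definition depth (d : nat) : Prop := forall (i : nat) a m (j : nat)
  (f : @rhom (Qk k) a m) (x : N a), (i < d)%N ->
  a + j%:Z = m -> (0 < j)%N -> a - j%:Z = i%:Z -> rep f (Sq j) ->
  fil i m (lm_act N f x) -> fil i a x.

(* For parity reasons Sq_i need not have a source hitting degree m. *)
Lemma fil_succ i m (y : N m) : (i < k)%N -> fil i.+1 m y ->
  fil i m y \/ exists a (j : nat) (f : @rhom (Qk k) a m) (x : N a),
   [/\ a + j%:Z = m, (0 < j)%N, a - j%:Z = i%:Z, rep f (Sq j)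
     & fil i m (y - lm_act N f x)].
Proof.
move=> ik; elim=> [_ [a [j [f [g [am j0 aj fj ->]]]]]||y1 y2 _ IH1 _ IH2].
- have [ai|ai] : a - j%:Z < i%:Z \/ a - j%:Z = i%:Z by lia.
    by left; apply: fil_gen fj.
  by right; exists a, j, f, g; split=> //; rewrite subrr; apply: (sg0 (fil _ _)).
- by left; apply: (sg0 (fil _ _)).
- case: IH1 IH2 => [H1|[a [j [f [x [am j0 aj fj H1]]]]]].
    case=> [H2|[a [j [f [x [am j0 aj fj H2]]]]]]; first by left; apply: sgB.
    right; exists a, j, f, (- x); split=> //.
    rewrite raddfN opprK -addrA [- y2 + _]addrC -opprB; exact: sgB.
  case=> [H2|[a' [j' [f' [x' [am' j0' aj' fj' H2]]]]]].
    by right; exists a, j, f, x; split=> //; rewrite addrAC; apply: sgB.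
  (* The equations a + j = m and a - j = i determine a and j, so both terms come from one operation
     and can be subtracted. *)
  have ea : a' = a by lia.
  have ej : j' = j by lia.
  subst a' j'; move: H2; rewrite (rep_inj fj' fj) => H2.
  right; exists a, j, f, (x - x'); split=> //.
  have -> : y1 - y2 - lm_act N f (x - x') = (y1 - lm_act N f x) - (y2 - lm_act N f x').
    by rewrite lm_actBr subrBB.
  exact: sgB.
Qed.

End Filtration.

(** * Depth of representable modules *)

Section Representable.
Variable k : nat.
Implicit Types a b m n : int.

Definition repr_mod n : lmodule (Qk k) :=
  @LModule (Qk k) (fun m => @rhom (Qk k) n m) (fun a b f g => rcomp f g)
    (fun a b f f' x => rcompDl f f' x) (fun a b f x y => rcompDr f x y)
    (fun a x => rcomp1l x) (fun a b c g f x => esym (rcompA g f x)).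

Lemma rep_char2 a b (f : @rhom (Qk k) a b) u : rep f u -> - f = f.
Proof.
move=> fu; apply/eqP; rewrite eq_sym -subr_eq0 opprK -mulr2n; apply/eqP.
by apply: rep_inj (repMn 2 fu) _; rewrite steenrod_char2; apply: rep0.
Qed.

(** The remainder z is 0 or the identity of n; [rep z 1] says the latter without transport along m =
    n. *)
Definition spanned n t m (y : repr_mod n m) : Prop :=
  exists z : repr_mod n m, (z = 0 \/ m = n /\ rep z 1) /\ fil (repr_mod n) t m (y - z).

Lemma spannedB n t m (y y' : repr_mod n m) :
  spanned t y -> spanned t y' -> spanned t (y - y').
Proof.
move=> [z [hz fz]] [z' [hz' fz']]; exists (z - z'); split; last first.
  by rewrite subrBB; apply: sgB.
case: hz => [->|[mn z1]]; case: hz' => [->|[mn' z1']]; rewrite ?subr0.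
- by left.
- by right; split=> //; rewrite sub0r (rep_char2 z1').
- by right.
- by left; rewrite (rep_inj z1 z1') subrr.
Qed.

(** A generator Sq^j with j > 0 out of n has lower index n - j below both k and n, and step min(k,
    n) is a submodule by [fil_Sq]. *)
Lemma repr_spanned (n : nat) m (y : repr_mod n m) : spanned (minn k n) y.
Proof.
suff H : forall a b (f : @rhom (Qk k) a b) (x : repr_mod n a),
    spanned (minn k n) x -> spanned (minn k n) (@rcomp (Qk k) _ _ _ f x : repr_mod n b).
  rewrite -[y]rcomp1r; apply: H.
  exists (@rid (Qk k) n); split; first by right; split=> //; apply: rep_id.
  by rewrite subrr; apply: (sg0 (fil _ _ _)).
apply: (@rep_ind k (fun a b f => forall x : repr_mod n a,
  spanned (minn k n) x -> spanned (minn k n) (@rcomp (Qk k) _ _ _ f x : repr_mod n b))).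
- move=> a b j f ab ajk fj x [z [hz fz]].
  have fxz : fil (repr_mod n) (minn k n) b (lm_act (repr_mod n) f (x - z)).
    by apply: fil_Sq fj fz => //; apply: geq_minl.
  have -> : @rcomp (Qk k) _ _ _ f x =
      lm_act (repr_mod n) f (x - z) - (- @rcomp (Qk k) _ _ _ f z).
    by rewrite lm_actBr opprK subrK.
  apply: spannedB.
    by exists 0; split; [left | rewrite subr0].
  case: hz => [->|[an z1]].
    by exists 0; split; [left | rewrite subr0 rcomp0r oppr0; apply: (sg0 (fil _ _ _))].
  rewrite (rep_char2 (rep_comp fj z1)).
  have [j0|j0] := posnP j.
    exists (@rcomp (Qk k) _ _ _ f z); split; last by rewrite subrr; apply: (sg0 (fil _ _ _)).
    right; split; first by lia.
    by have := rep_comp fj z1; rewrite j0 Sq0 mulr1.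
  exists 0; split; [by left | rewrite subr0].
  by apply: (fil_gen (N := repr_mod n)) fj => //; lia.
- move=> a b x _; rewrite rcomp0l; exists 0; split; [by left|].
  by rewrite subrr; apply: (sg0 (fil _ _ _)).
- by move=> a x; rewrite rcomp1l.
- move=> a b f g IHf IHg x hx; rewrite rcompBl; apply: spannedB; [exact: IHf | exact: IHg].
- by move=> a b c f g IHf IHg x hx; rewrite -rcompA; apply/IHg/IHf.
Qed.

(* Evaluation of y at the fundamental class of F_2[x_1, ..., x_r], viewed in
   degree n after n - r suspensions. *)
Definition kills n (r : nat) m (y : repr_mod n m) : Prop :=
  exists2 u, rep y u & st_act u (var_prod r) = 0.

Lemma killsP n (r : nat) m (y : repr_mod n m) u :
  r%:Z <= n -> kills r y -> rep y u -> st_act u (var_prod r) = 0.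
Proof.
move=> rn [v yv v0] yu; rewrite -[RHS]v0.
exact: rep_st_act yu yv (var_prod_hom r) rn.
Qed.

Lemma killsB n (r : nat) m (y z : repr_mod n m) :
  kills r y -> kills r z -> kills r (y - z).
Proof.
move=> [u yu u0] [v zv v0]; exists (u - v); first exact: repB.
by rewrite st_actB u0 v0 subrr.
Qed.

(** The value of g has degree (n - i) + (a - n) = a - i < j, so Sq^j kills it by instability. *)
Lemma fil_kills (n i : nat) m (y : repr_mod n m) : (i <= n)%N ->
  fil (repr_mod n) i m y -> kills (n - i) y.
Proof.
move=> i_n; elim=> [_ [a [j [f [g [am j0 aj fj ->]]]]]||y1 y2 _ IH1 _ IH2].
- have [u gu ud] := rep_ex g; exists (Sq j * u); first exact: rep_comp.
  rewrite st_actM st_act_Sq.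
  apply: (sqhom_unstable (st_act_hom ud (var_prod_hom _))); lia.
- by exists 0; [exact: rep0 | exact: st_act0].
- exact: killsB.
Qed.

(** The value of x has degree a - i = j, so Sq^j squares it, which is injective in a domain. *)
Lemma kills_top (n i : nat) a m (j : nat) (f : @rhom (Qk k) a m) (x : repr_mod n a) :
  (i <= n)%N -> a - j%:Z = i%:Z -> rep f (Sq j) ->
  kills (n - i) (lm_act (repr_mod n) f x) -> kills (n - i) x.
Proof.
move=> i_n aj fj fx; have [u xu ud] := rep_ex x; exists u => //.
have := killsP (n := n) _ fx (rep_comp fj xu).
rewrite st_actM st_act_Sq [sq _ _](sqhom_top (st_act_hom ud (var_prod_hom _))); last by lia.
have rn : (n - i)%N%:Z <= n%:Z by lia.
by move=> /(_ rn)/eqP; rewrite expf_eq0 => /eqP.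
Qed.

(** Descending induction on i from min(k, n), then induction on m. If y kills x_1...x_(n-i), it
    kills the shorter product, so it lies in step i + 1 and equals Sq_i x modulo step i. Then x
    kills x_1...x_(n-i) as well and, having lower degree, lies in step i. *)
Lemma kills_fil (n i : nat) m (y : repr_mod n m) : (i <= minn k n)%N ->
  kills (n - i) y -> fil (repr_mod n) i m y.
Proof.
move=> it; have [s] : exists s, (i + s = minn k n)%N by exists (minn k n - i)%N; lia.
elim: s => [|s IHs] in i m y it *.
  rewrite addn0 => ->; have [z [[->|[mn z1]] fz]] := repr_spanned y.
    by rewrite subr0 in fz.
  (* If z is the identity, both y and y - z kill x_1...x_r, hence so does z, although this product
     is nonzero. *)
  move=> yk; have [u yu _] := rep_ex y.
  have tn : (minn k n <= n)%N by exact: geq_minr.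
  have rn : (n - minn k n)%N%:Z <= n%:Z by lia.
  have := killsP rn (fil_kills tn fz) (repB yu z1).
  rewrite st_actB (killsP rn yk yu) st_act1 sub0r => /eqP.
  by rewrite oppr_eq0 (negPf (var_prod_neq0 _)).
move=> ist; have [M mM] : exists M : nat, m < M%:Z by exists `|m|.+1%N; lia.
elim: M => [|M IHM] in m y mM *.
  by move=> _; rewrite (lm_neg y) //; apply: (sg0 (fil _ _ _)).
have i_n : (i <= n)%N by lia.
have ik : (i <= k)%N by lia.
have rn : (n - i)%N%:Z <= n%:Z by lia.
have rn' : (n - i.+1)%N%:Z <= n%:Z by lia.
move=> yk; have [u yu ud] := rep_ex y.
have yk' : kills (n - i.+1) y.
  exists u => //; apply: st_act_var_prod ud _.
  have -> : (n - i.+1).+1 = (n - i)%N by lia.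
  exact: killsP yk yu.
have fy : fil (repr_mod n) i.+1 m y by apply: IHs => //; lia.
have i_k : (i < k)%N by lia.
have [//|[a [j [f [x [am j0 aj fj fyx]]]]]] := fil_succ i_k fy.
have kx : kills (n - i) x.
  apply: kills_top aj fj _ => //.
  have -> : lm_act (repr_mod n) f x = y - (y - lm_act (repr_mod n) f x).
    by rewrite opprB addrCA subrr addr0.
  by apply: killsB => //; apply: fil_kills.
rewrite -[y](subrK (lm_act (repr_mod n) f x)); apply: (@sgD _ (fil _ i m)) => //.
by apply: fil_Sq fj _ => //; [lia | apply: IHM => //; lia].
Qed.

Lemma repr_depth n : depth (repr_mod n) k.
Proof.
move=> i a m j f x ik am j0 aj fj fx.
have [n0|] := ltP n 0.
  rewrite -[x]rcomp1r (lm_neg (@rid (Qk k) n : repr_mod n n)) // rcomp0r.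
  exact: (sg0 (fil _ _ _)).
case: n x fx => // n x fx _; have [i_n|ni] := ltnP i n.
  apply: kills_fil; first by lia.
  by apply: kills_top aj fj _; [lia | apply: fil_kills fx; lia].
(* For i >= n an identity part would need a = n, whereas a = i + j > n. *)
have [z [[->|[an _]] fz]] := repr_spanned x; last by lia.
by apply: fil_mono (_ : (minn k n <= i)%N) _; [lia | rewrite subr0 in fz].
Qed.

End Representable.

(** * Free modules *)

Section DirectProduct.
Variables (I : choiceType) (V : I -> zmodType).

Definition dprod : Type := forall i, V i.
HB.instance Definition _ := gen_eqMixin dprod.
HB.instance Definition _ := gen_choiceMixin dprod.

Lemma dprodP (f g : dprod) : (forall i, f i = g i) -> f = g.
Proof. exact: functional_extensionality_dep. Qed.

Definition dprod_add (f g : dprod) : dprod := fun i => f i + g i.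
Definition dprod_opp (f : dprod) : dprod := fun i => - f i.
Definition dprod_zero : dprod := fun i => 0.

Lemma dprod_addA : associative dprod_add.
Proof. by move=> f g h; apply: dprodP => i; apply: addrA. Qed.
Lemma dprod_addC : commutative dprod_add.
Proof. by move=> f g; apply: dprodP => i; apply: addrC. Qed.
Lemma dprod_add0 : left_id dprod_zero dprod_add.
Proof. by move=> f; apply: dprodP => i; apply: add0r. Qed.
Lemma dprod_addN : left_inverse dprod_zero dprod_opp dprod_add.
Proof. by move=> f; apply: dprodP => i; apply: addNr. Qed.

HB.instance Definition _ := GRing.isZmodule.Build dprod
  dprod_addA dprod_addC dprod_add0 dprod_addN.

Definition finite_support : subgroup dprod.
Proof.
refine (@Subgroup dprod (fun f => exists s : seq I, forall i, i \notin s -> f i = 0) _ _).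
- by exists [::].
- move=> f g [s fs] [t gt]; exists (s ++ t) => i.
  by rewrite mem_cat negb_or => /andP[/fs fi /gt gi]; rewrite -[LHS]/(f i - g i) fi gi subrr.
Defined.

Definition dsum : zmodType := subg finite_support.

Definition dsum_supp (f : dsum) : seq I := undup (projT1 (cid (subgP f))).

Lemma dsum_suppP (f : dsum) i : i \notin dsum_supp f -> (val f : dprod) i = 0.
Proof. by rewrite mem_undup; apply: (projT2 (cid (subgP f))). Qed.

Lemma big_supp (A : zmodType) (F : I -> A) (s t : seq I) : uniq s -> uniq t ->
  (forall i, i \notin s -> F i = 0) -> (forall i, i \notin t -> F i = 0) ->
  \sum_(i <- s) F i = \sum_(i <- t) F i.
Proof.
move=> us ut Fs Ft.
have E r : \sum_(i <- r) F i = \sum_(i <- [seq i <- r | F i != 0]) F i.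
  rewrite (bigID (fun i => F i != 0)) /= [X in _ + X]big1 ?addr0 ?big_filter //.
  by move=> i; rewrite negbK => /eqP.
rewrite E [RHS]E; apply: perm_big; apply: uniq_perm; rewrite ?filter_uniq // => i.
rewrite !mem_filter; case: eqP => //= Fi.
have -> : i \in s by apply/negPn/negP => /Fs.
by apply/esym/negPn/negP => /Ft.
Qed.

End DirectProduct.

Section DirectSum.
Variables (C : ringoid) (I : choiceType) (V : I -> lmodule C).
Implicit Types a b : C.

Definition dsum_at a : zmodType := dsum (fun i => V i a).
Definition dget a (f : dsum_at a) i : V i a := (val f : dprod _) i.

Lemma dgetP a (f g : dsum_at a) : (forall i, dget f i = dget g i) -> f = g.
Proof. by move=> fg; apply/val_inj/dprodP. Qed.

Lemma dgetD a (f g : dsum_at a) i : dget (f + g) i = dget f i + dget g i.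
Proof. by []. Qed.

Lemma dsum_act_subproof a b (h : rhom a b) (f : dsum_at a) :
  finite_support _ ((fun i => lm_act (V i) h (dget f i)) : dprod (fun i => V i b)).
Proof.
by have [s fs] := subgP f; exists s => i /fs; rewrite /dget => ->; rewrite raddf0.
Qed.

Definition dsum_act a b (h : rhom a b) (f : dsum_at a) : dsum_at b :=
  mk_subg (dsum_act_subproof h f).

Definition dsum_mod : lmodule C.
Proof.
refine (@LModule C dsum_at dsum_act _ _ _ _).
- by move=> a b h h' f; apply: dgetP => i; apply: lm_actDl.
- by move=> a b h f g; apply: dgetP => i; apply: lm_actDr.
- by move=> a f; apply: dgetP => i; apply: lm_act1.
- by move=> a b c h h' f; apply: dgetP => i; apply: lm_actM.
Defined.

Definition dsum_proj i : lmhom dsum_mod (V i).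
Proof. by refine (@LMHom C dsum_mod (V i) (fun a f => dget f i) _ _). Defined.

Definition delta i a (x : V i a) : dprod (fun j => V j a) :=
  fun j => match i =P j with
           | ReflectT e => ecast j (V j a) e x
           | ReflectF _ => 0 end.

Lemma delta_same i a (x : V i a) : delta x i = x.
Proof. by rewrite /delta; case: eqP => // e; rewrite eq_axiomK. Qed.

Lemma delta_other i j a (x : V i a) : i <> j -> delta x j = 0.
Proof. by rewrite /delta; case: eqP. Qed.

Lemma delta_support i a (x : V i a) : finite_support _ (delta x).
Proof.
exists [:: i] => j; rewrite inE => /eqP ij; apply: delta_other.
by move=> E; apply: ij.
Qed.

Definition dsum_in i : lmhom (V i) dsum_mod.
Proof.
refine (@LMHom C (V i) dsum_mod (fun a x => mk_subg (delta_support x)) _ _).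
- move=> a x y; apply: dgetP => j; rewrite dgetD /dget /=.
  have [<-|ij] := pselect (i = j); first by rewrite !delta_same.
  by rewrite !delta_other // addr0.
- move=> a b f x; apply: dgetP => j; rewrite /dget /= /dget /=.
  have [<-|ij] := pselect (i = j); first by rewrite !delta_same.
  by rewrite !delta_other // raddf0.
Defined.

Lemma dget_in_same i a (x : V i a) : dget (dsum_in i a x) i = x.
Proof. exact: delta_same. Qed.

Lemma dget_in_other i j a (x : V i a) : i <> j -> dget (dsum_in i a x) j = 0.
Proof. exact: delta_other. Qed.

Variables (N : lmodule C) (phi : forall i, lmhom (V i) N).

Definition dsum_desc_fun a (f : dsum_at a) : N a :=
  \sum_(i <- dsum_supp f) phi i a (dget f i).

(** The chosen support can be exchanged for another list, so that two elements are summed over a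
    common one. *)
Lemma dsum_desc_supp a (f : dsum_at a) (s : seq I) : uniq s ->
  (forall i, i \notin s -> dget f i = 0) ->
  dsum_desc_fun f = \sum_(i <- s) phi i a (dget f i).
Proof.
move=> us fs; apply: big_supp => // [|i /dsum_suppP fi|i /fs fi].
- exact: undup_uniq.
- by rewrite [dget f i]fi raddf0.
- by rewrite fi raddf0.
Qed.

Definition dsum_desc : lmhom dsum_mod N.
Proof.
refine (@LMHom C dsum_mod N dsum_desc_fun _ _).
- move=> a f g; set s := undup (dsum_supp f ++ dsum_supp g).
  have sP i : i \notin s -> dget f i = 0 /\ dget g i = 0.
    rewrite mem_undup mem_cat negb_or => /andP[fi gi].
    by split; apply: dsum_suppP.
  have us : uniq s by apply: undup_uniq.
  rewrite !(@dsum_desc_supp a _ s) // => [|i /sP[]|i /sP[]|i /sP[fi gi]] //.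
    by rewrite -big_split; apply: eq_bigr => i _; rewrite dgetD raddfD.
  by rewrite dgetD fi gi addr0.
- move=> a b h f; rewrite (@dsum_desc_supp b _ (dsum_supp f)).
  + by rewrite [RHS]raddf_sum; apply: eq_bigr => i _; apply: lm_map_act.
  + exact: undup_uniq.
  + by move=> i /dsum_suppP fi; rewrite /dget /= [dget f i]fi raddf0.
Defined.

Lemma dsum_desc_in i a (x : V i a) : dsum_desc a (dsum_in i a x) = phi i a x.
Proof.
rewrite [LHS](@dsum_desc_supp a _ [:: i]) //.
  by rewrite big_seq1 dget_in_same.
by move=> j; rewrite inE => /eqP ij; apply: dget_in_other => E; apply: ij.
Qed.

End DirectSum.

Lemma dsum_ind (C : ringoid) (I : choiceType) (V : I -> lmodule C) (a : C)
    (X : dsum_mod V a -> Prop) :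
  X 0 -> (forall f g, X f -> X g -> X (f + g)) ->
  forall f, (forall i, X (dsum_in V i a (dget f i))) -> X f.
Proof.
move=> X0 XD f Xf.
have -> : f = \sum_(i <- dsum_supp f) dsum_in V i a (dget f i).
  apply: dgetP => j.
  rewrite [RHS](raddf_sum (dsum_proj V j a)) /=.
  have [jf|jf] := boolP (j \in dsum_supp f); last first.
    rewrite [LHS](dsum_suppP jf) big_seq big1 // => i i_f.
    by apply: dget_in_other => E; rewrite -E i_f in jf.
  rewrite (bigD1_seq j) //= ?undup_uniq // big1 ?addr0 ?dget_in_same //.
  by move=> i /eqP ij; apply: dget_in_other.
by apply: big_ind => // i _.
Qed.

Section FreeModules.
Variable k : nat.

Definition yoneda (N : lmodule (Qk k)) (n : int) (x : N n) : lmhom (repr_mod k n) N.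
Proof.
refine (@LMHom (Qk k) (repr_mod k n) N (fun a f => lm_act N f x) _ _).
- by move=> a f g; apply: lm_actDl.
- by move=> a b h f; apply: lm_actM.
Defined.

Definition free_mod (I : choiceType) (deg : I -> int) : lmodule (Qk k) :=
  dsum_mod (fun i => repr_mod k (deg i)).

Definition free_gen (I : choiceType) (deg : I -> int) i : free_mod deg (deg i) :=
  dsum_in (fun i => repr_mod k (deg i)) i (deg i) (@rid (Qk k) (deg i)).

Lemma free_genE (I : choiceType) (deg : I -> int) i a (f : @rhom (Qk k) (deg i) a) :
  dsum_in (fun i => repr_mod k (deg i)) i a f = lm_act (free_mod deg) f (free_gen deg i).
Proof.
rewrite /free_gen -lm_map_act; congr (lm_map _ a _).
by apply/esym; apply: (@rcomp1r (Qk k)).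
Qed.

Lemma lm_eq_free (I : choiceType) (deg : I -> int) (N : lmodule (Qk k))
    (f g : lmhom (free_mod deg) N) :
  (forall i, f (deg i) (free_gen deg i) = g (deg i) (free_gen deg i)) ->
  forall a x, f a x = g a x.
Proof.
move=> fg a x; apply: (dsum_ind (X := fun x => f a x = g a x)) => [|y z fy fz|i].
- by rewrite !raddf0.
- by rewrite !lm_mapD fy fz.
- by rewrite free_genE !lm_map_act fg.
Qed.

Definition free_desc (I : choiceType) (deg : I -> int) (N : lmodule (Qk k))
    (x : forall i, N (deg i)) : lmhom (free_mod deg) N :=
  dsum_desc (fun i => yoneda (x i)).

Lemma free_desc_gen (I : choiceType) (deg : I -> int) (N : lmodule (Qk k))
    (x : forall i, N (deg i)) i : free_desc x (deg i) (free_gen deg i) = x i.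
Proof. by rewrite [LHS]dsum_desc_in /= lm_act1. Qed.

Lemma lm_comp_subproof (M N P : lmodule (Qk k)) (f : lmhom M N) (g : lmhom N P) a b
    (h : @rhom (Qk k) a b) (x : M a) :
  g b (f b (lm_act M h x)) = lm_act P h (g a (f a x)).
Proof. by rewrite !lm_map_act. Qed.

Definition lm_comp (M N P : lmodule (Qk k)) (f : lmhom M N) (g : lmhom N P) : lmhom M P.
Proof.
refine (@LMHom _ M P (fun a x => g a (f a x)) _ _).
- by move=> a x y; rewrite !raddfD.
- exact: lm_comp_subproof.
Defined.

Lemma free_projective (I : choiceType) (deg : I -> int) : lm_projective (free_mod deg).
Proof.
move=> M N p g p_surj.
have [x xP] : exists x : forall i, M (deg i),
    forall i, p (deg i) (x i) = g (deg i) (free_gen deg i).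
  pose H i := cid (p_surj (deg i) (g (deg i) (free_gen deg i))).
  by exists (fun i => projT1 (H i)) => i; apply: (projT2 (H i)).
exists (free_desc x); apply: (@lm_eq_free _ _ _ (lm_comp (free_desc x) p) g) => i.
by rewrite -xP /= [LHS](congr1 (p _) (free_desc_gen _ _)).
Qed.

Lemma fil_map (M N : lmodule (Qk k)) (f : lmhom M N) i m (x : M m) :
  fil M i m x -> fil N i m (f m x).
Proof.
elim=> [_ [a [j [h [g [am j0 aj hj ->]]]]]||y z _ IHy _ IHz].
- by rewrite lm_map_act; apply: fil_gen hj.
- by rewrite raddf0; apply: (sg0 (fil _ _ _)).
- by rewrite raddfB; apply: sgB.
Qed.

Lemma fil_dsum (I : choiceType) (V : I -> lmodule (Qk k)) i m (f : dsum_mod V m) :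
  fil (dsum_mod V) i m f <-> forall j, fil (V j) i m (dget f j).
Proof.
split=> [ff j|ff]; first exact: (fil_map (dsum_proj V j) ff).
apply: dsum_ind => [|g h|j].
- exact: (sg0 (fil _ _ _)).
- exact: sgD.
- exact: fil_map.
Qed.

Lemma depth_dsum (I : choiceType) (V : I -> lmodule (Qk k)) d :
  (forall j, depth (V j) d) -> depth (dsum_mod V) d.
Proof.
move=> dV i a m j f x id am j0 aj fj /fil_dsum fx; apply/fil_dsum => l.
by apply: (dV l) fj _ => //; apply: fx.
Qed.

Lemma free_depth (I : choiceType) (deg : I -> int) : depth (free_mod deg) k.
Proof. by apply: depth_dsum => i; apply: repr_depth. Qed.

End FreeModules.

(** * Kernels and modules of depth k *)

Lemma lm_mapB (C : ringoid) (M N : lmodule C) (f : lmhom M N) (a : C) (x y : M a) :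
  f a (x - y) = f a x - f a y.
Proof. exact: raddfB. Qed.

Lemma spanD (V : zmodType) (S : V -> Prop) x y : span S x -> span S y -> span S (x + y).
Proof. exact: (@sgD _ (spang S)). Qed.

Lemma span_mono (V : zmodType) (S T : V -> Prop) x :
  (forall y, S y -> T y) -> span S x -> span T x.
Proof.
move=> ST; elim=> [y /ST Ty||y z _ IHy _ IHz].
- exact: span_gen.
- exact: span_zero.
- exact: span_sub.
Qed.

(** * Bases modulo a subgroup, by Zorn's lemma *)

Section BasisModulo.
Variables (V : zmodType) (W : subgroup V).
Hypothesis char2 : forall x : V, x *+ 2 = 0.

Definition independent (B : V -> Prop) : Prop :=
  forall b, B b -> ~ span (fun x => W x \/ B x /\ x <> b) b.

Lemma basis_mod_ex : exists B, independent B /\ forall x, span (fun x => W x \/ B x) x.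
Proof.
have [F FP Ftot|A [indA maxA]] := @classical_sets.Zorn_bigcup V independent.
  move=> b [X FX Xb] sb.
  (* A span element uses finitely many generators, so one member of the chain contains them all. *)
  have H c : span (fun x => W x \/ classical_sets.bigcup F id x /\ x <> b) c ->
      exists2 Y, F Y & Y b /\ span (fun x => W x \/ Y x /\ x <> b) c.
    elim=> [x [Wx|[[Y FY Yx] xb]]||x y _ [Y FY [Yb sY]] _ [Z FZ [Zb sZ]]].
    - by exists X => //; split=> //; apply: span_gen; left.
    - have [XY|YX] := Ftot X Y FX FY.
        by exists Y => //; split; [apply: XY | apply: span_gen; right].
      by exists X => //; split=> //; apply: span_gen; right; split=> //; apply: YX.
    - by exists X => //; split=> //; apply: span_zero.
    - have [YZ|ZY] := Ftot Y Z FY FZ.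
        exists Z => //; split=> //; apply: span_sub => //; apply: span_mono sY.
        by move=> w [Ww|[Yw wb]]; [left | right; split=> //; apply: YZ].
      exists Y => //; split=> //; apply: span_sub => //; apply: span_mono sZ.
      by move=> w [Ww|[Zw wb]]; [left | right; split=> //; apply: ZY].
  have [Y FY [Yb sY]] := H b sb.
  exact: (FP Y FY b Yb sY).
exists A; split=> // x; apply: contrapT => nx.
have Ax : ~ A x by move=> Ax; apply: nx; apply: span_gen; right.
apply: (maxA (fun y => A y \/ y = x)).
  split; first by move=> y Ay; left.
  by move=> /(_ x (or_intror erefl)).
move=> b [Ab|->] sb; last first.
  by apply: nx; apply: span_mono sb => w [Ww|[[Aw|//] _]]; [left | right].
(* In characteristic 2 the new element x occurs with coefficient 0 or 1. *)
have H c : span (fun y => W y \/ (A y \/ y = x) /\ y <> b) c ->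
    exists2 s, span (fun x => W x \/ A x /\ x <> b) s & c = s \/ c = s + x.
  elim=> [y [Wy|[[Ay|->] yb]]||y z _ [s Ss ys] _ [t St zt]].
  - by exists y; [apply: span_gen; left | left].
  - by exists y; [apply: span_gen; right | left].
  - by exists 0; [apply: span_zero | right; rewrite add0r].
  - by exists 0; [apply: span_zero | left].
  - exists (s - t); first exact: span_sub.
    case: ys zt => -> [->|->].
    + by left.
    + right; rewrite opprD addrA; congr (_ + _).
      by apply/eqP; rewrite eq_sym -subr_eq0 opprK -mulr2n char2.
    + by right; rewrite addrAC.
    + by left; rewrite opprD addrACA subrr addr0.
have [s sA [E|E]] := H b sb; first by apply: (indA b Ab); rewrite {2}E.
apply: nx; have -> : x = b - s by rewrite E addrC addKr.
apply: span_sub; first by apply: span_gen; right.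
by apply: span_mono sA => w [Ww|[Aw _]]; [left | right].
Qed.

End BasisModulo.

Section Kernels.
Variables (k : nat) (M N : lmodule (Qk k)) (f : lmhom M N).

Definition ker_sg (a : int) : subgroup (M a).
Proof.
refine (@Subgroup (M a) (fun x => f a x = 0) _ _).
- exact: raddf0.
- by move=> x y /= fx fy; rewrite raddfB /= fx fy subrr.
Defined.

Lemma ker_act_subproof a b (h : @rhom (Qk k) a b) (x : subg (ker_sg a)) :
  ker_sg b (lm_act M h (val x)).
Proof. by rewrite /= lm_map_act [f a _](subgP x) raddf0. Qed.

Definition lm_ker : lmodule (Qk k).
Proof.
refine (@LModule (Qk k) (fun a => subg (ker_sg a))
  (fun a b h x => mk_subg (ker_act_subproof h x)) _ _ _ _).
- by move=> a b h h' x; apply: val_inj; apply: lm_actDl.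
- by move=> a b h x y; apply: val_inj; apply: lm_actDr.
- by move=> a x; apply: val_inj; apply: lm_act1.
- by move=> a b c g h x; apply: val_inj; apply: lm_actM.
Defined.

Definition ker_in : lmhom lm_ker M.
Proof. by refine (@LMHom _ lm_ker M (fun a x => val x) _ _). Defined.

Definition ker_mk a (x : M a) (fx : f a x = 0) : lm_ker a := @mk_subg _ (ker_sg a) x fx.

Lemma ker_inP a (x : lm_ker a) : f a (ker_in a x) = 0.
Proof. exact: (subgP x). Qed.

Lemma ker_in_inj a (x y : lm_ker a) : ker_in a x = ker_in a y -> x = y.
Proof. exact: val_inj. Qed.

Hypothesis f_surj : lm_surjective f.

Lemma fil_lift i m (y : N m) : fil N i m y -> exists2 x, fil M i m x & f m x = y.
Proof.
elim=> [_ [a [j [h [g [am j0 aj hj ->]]]]]||y1 y2 _ [x1 Mx1 <-] _ [x2 Mx2 <-]].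
- have [g' <-] := f_surj g; exists (lm_act M h g'); last exact: lm_map_act.
  exact: fil_gen hj.
- by exists 0; [exact: (sg0 (fil _ _ _)) | rewrite raddf0].
- by exists (x1 - x2); [exact: sgB | rewrite raddfB].
Qed.

Lemma fil0 (P : lmodule (Qk k)) m (x : P m) : fil P 0 m x -> x = 0.
Proof.
elim=> [_ [a [j [h [g [am j0 aj hj ->]]]]]|//|y z _ -> _ ->]; last by rewrite subrr.
by rewrite (rep_unstable am _ hj) ?lm_act0 //; lia.
Qed.

(** Up to step d the kernel carries the filtration induced from M. If y = Sq_i x modulo M^i, depth
    puts f x in N^i; lifting it to w in M^i, the element x - w lies in the kernel and y = Sq_i (x -
    w) modulo M^i. *)
Lemma fil_ker d i m (y : lm_ker m) : depth N d -> (d <= k)%N -> (i <= d)%N ->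
  fil M i m (ker_in m y) -> fil lm_ker i m y.
Proof.
move=> dN dk; elim: i y => [|i IH] y id.
  move=> /fil0 y0; have -> : y = 0 by apply: ker_in_inj; rewrite y0 raddf0.
  exact: (sg0 (fil _ _ _)).
have ik : (i < k)%N by lia.
case/(fil_succ ik) => [fy|[a [j [h [x [am j0 aj hj fy]]]]]].
  by apply: fil_mono (leqnSn i) _; apply: IH => //; lia.
have fhx : fil N i m (lm_act N h (f a x)).
  have := fil_map f fy; rewrite lm_mapB ker_inP sub0r lm_map_act => /sgN.
  by rewrite opprK.
have [w Mw fw] := fil_lift (dN _ _ _ _ _ _ id am j0 aj hj fhx).
have fxw : f a (x - w) = 0 by rewrite lm_mapB fw subrr.
set z : lm_ker a := ker_mk fxw.
have fz : fil lm_ker i.+1 m (lm_act lm_ker h z) by apply: fil_gen hj => //; lia.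
rewrite -[y](subrK (lm_act lm_ker h z)); apply: (@sgD _ (fil _ _ m)) => //.
apply: fil_mono (leqnSn i) _; apply: IH; first by lia.
rewrite lm_mapB lm_map_act.
have -> : ker_in m y - lm_act M h (ker_in a z) =
    (ker_in m y - lm_act M h x) + lm_act M h w.
  by rewrite /= lm_actBr opprB addrCA addrC.
apply: (@sgD _ (fil _ _ m)) => //; apply: fil_Sq hj Mw => //; lia.
Qed.

(** The gain of one arises because [fil_ker] holds for i <= d, while depth d concerns i < d only. *)
Lemma depth_ker d : depth M k -> depth N d -> (d < k)%N -> depth lm_ker d.+1.
Proof.
move=> dM dN dk i a m j h x id am j0 aj hj fx.
apply: (fil_ker dN) => //; first by lia.
apply: dM am j0 aj hj _; first by lia.
by rewrite -lm_map_act; apply: fil_map.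
Qed.

End Kernels.

(** * Modules of depth k are free *)

Section Freeness.
Variables (k : nat) (N : lmodule (Qk k)).

Lemma lm_char2 m (x : N m) : x *+ 2 = 0.
Proof.
rewrite mulr2n -{2}[x](lm_act1 x) -{1}[x](lm_act1 x) -lm_actDl -mulr2n.
have -> : @rid (Qk k) m *+ 2 = 0; last exact: lm_act0.
by apply: rep_inj (repMn 2 (rep_id k m)) _; rewrite steenrod_char2; apply: rep0.
Qed.

Lemma repr_spanned_all n m (y : repr_mod k n m) : spanned k y.
Proof.
have [n0|] := ltP n 0.
  have -> : y = 0 by rewrite -[y]rcomp1r (lm_neg (@rid (Qk k) n : repr_mod k n n)) // rcomp0r.
  by exists 0; split; [left | rewrite subrr; apply: (sg0 (fil _ _ _))].
case: n y => // n y _; have [z [hz fz]] := repr_spanned y.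
by exists z; split=> //; apply: fil_mono fz; apply: geq_minl.
Qed.

(** The generators lift a basis of N/N^k. Surjectivity is an induction on the degree; for
    injectivity [nakayama] is applied to the kernel, whose step k is induced from the free module by
    [fil_ker]. *)
Lemma free_of_depth : depth N k ->
  exists (I : choiceType) (deg : I -> int) (f : lmhom (free_mod k deg) N),
    lm_surjective f /\ forall a x, f a x = 0 -> x = 0.
Proof.
move=> dN.
have [B BP] : exists B : forall m, N m -> Prop, forall m,
    independent (fil N k m) (B m) /\
    forall x, span (fun x => fil N k m x \/ B m x) x.
  pose H m := cid (basis_mod_ex (fil N k m) (@lm_char2 m)).
  by exists (fun m => projT1 (H m)) => m; apply: (projT2 (H m)).
pose J := {m : int & {x : N m | B m x}}.
pose I : choiceType := {classic J}.
pose deg (p : I) : int := tag (p : J).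
pose gen (p : I) : N (deg p) := sval (tagged (p : J)).
have genB p : B _ (gen p) := svalP (tagged (p : J)).
exists I, deg, (free_desc gen).
have f_surj : lm_surjective (free_desc gen).
  move=> m y; have [n mn] : exists n : nat, m < n%:Z by exists `|m|.+1%N; lia.
  elim: n m y mn => [|n IH] m y mn.
    by exists 0; rewrite raddf0 [y](lm_neg y) //; lia.
  elim: ((BP m).2 y) => {y} [y [Ny|By]||y z _ [u <-] _ [v <-]].
  - elim: Ny => {y} [_ [a [j [h [g [am j0 aj hj ->]]]]]||y z _ [u <-] _ [v <-]].
    + have [|u <-] := IH a g; first by lia.
      by exists (lm_act _ h u); rewrite lm_map_act.
    + by exists 0; rewrite raddf0.
    + by exists (u - v); rewrite lm_mapB.
  - pose p : I := existT _ m (exist _ y By).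
    by exists (free_gen k deg p); exact: (free_desc_gen gen p).
  - by exists 0; rewrite raddf0.
  - by exists (u - v); rewrite lm_mapB.
(* Modulo N^k only an identity part of g survives, and it returns [gen p], which is not [gen q]. *)
have act_gen p n (g : repr_mod k (deg p) n) (q : I) (e : deg q = n) : p <> q ->
    span (fun x => fil N k n x \/ B n x /\ x <> ecast n (N n) e (gen q))
      (lm_act N g (gen p)).
  move=> pq; have [z [hz fz]] := repr_spanned_all g.
  rewrite -[g](subrK z) lm_actDl; apply: spanD.
    by apply: span_gen; left; apply: (fil_map (yoneda (gen p)) fz).
  case: hz => [->|[np z1]]; first by rewrite lm_act0; apply: span_zero.
  move: z z1 e {g fz}; rewrite np => z z1 e.
  rewrite (rep_inj z1 (rep_id k (deg p))) lm_act1.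
  apply: span_gen; right; split; first exact: genB.
  case: p pq e {np z z1} => m [b Bb] pq; case: q pq => m' [b' Bb'] pq /= e.
  move: e b Bb pq; rewrite /deg /= => e; case: m / e => b Bb pq /= bb'.
  by apply: pq; congr existT; apply: eq_exist.
(* Modulo N^k and the other basis elements, the image of v depends only on its p-th coordinate. *)
have coord p (v : free_mod k deg (deg p)) :
    span (fun x => fil N k (deg p) x \/ B (deg p) x /\ x <> gen p)
      (free_desc gen (deg p) v - lm_act N (dget v p) (gen p)).
  apply: (dsum_ind (X := fun v =>
    span (fun x => fil N k (deg p) x \/ B (deg p) x /\ x <> gen p)
      (free_desc gen (deg p) v - lm_act N (dget v p) (gen p)))) => [|u w Hu Hw|q].
  - by rewrite raddf0 lm_act0 subrr; apply: span_zero.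
  - by rewrite lm_mapD dgetD lm_actDl opprD addrACA; apply: spanD.
  - rewrite [free_desc gen _ _]dsum_desc_in /=.
    have [->|qp] := pselect (q = p).
      by rewrite dget_in_same subrr; apply: span_zero.
    rewrite (dget_in_other _ qp) lm_act0 subr0.
    exact: (act_gen q (deg p) (dget v q) p erefl qp).
split=> // m x fx.
suff K0 a (y : lm_ker (free_desc gen) a) : y = 0.
  by have := K0 m (ker_mk fx) => /(congr1 val).
apply: nakayama => {m x fx a y} m y.
apply: (fil_ker f_surj dN) => //.
apply/fil_dsum => p; have [z [[->|[mp z1]] fz]] :=
  repr_spanned_all (dget (ker_in _ m y) p).
  by rewrite subr0 in fz.
(* An identity part in the p-th coordinate of a kernel element would put [gen p] in the span of N^k
   and the other basis elements. *)
exfalso; move: y z z1 fz; rewrite mp => y z z1 fz.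
have [indB _] := BP (deg p); apply: (indB _ (genB p)).
have := coord p (ker_in _ _ y); rewrite ker_inP sub0r.
rewrite -[dget _ p](subrK z) lm_actDl.
rewrite (rep_inj z1 (rep_id k (deg p))) lm_act1 => H.
have spanE (S : N (deg p) -> Prop) w g : span S w -> span S (- (w + g)) -> span S g.
  move=> Sw Swg; have -> : g = 0 - - (w + g) - w by rewrite sub0r opprK addrC addKr.
  by do 2![apply: span_sub => //]; apply: span_zero.
apply: spanE H; rewrite -(rep_inj z1 (rep_id k (deg p))).
by apply: span_gen; left; apply: (fil_map (yoneda (gen p)) fz).
Qed.

End Freeness.

(** * Resolutions *)

Section Resolution.
Variable k : nat.

Definition has_resolution (n : nat) (M : lmodule (Qk k)) : Prop :=
  exists (P : nat -> lmodule (Qk k)) (d : forall i, lmhom (P i.+1) (P i))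
    (e : lmhom (P 0%N) M), proj_resolution n d e.

Definition zero_mod : lmodule (Qk k) := free_mod k (fun v : void => match v with end).

Lemma zero_modP : lm_zero zero_mod.
Proof. by move=> a x; apply: dgetP => -[]. Qed.

Definition zero_hom (M N : lmodule (Qk k)) : lmhom M N.
Proof.
refine (@LMHom _ M N (fun a _ => 0) _ _).
- by move=> a x y; rewrite addr0.
- by move=> a b f x; rewrite raddf0.
Defined.

Lemma has_resolution0 (P M : lmodule (Qk k)) (f : lmhom P M) :
  lm_projective P -> lm_surjective f -> (forall a x, f a x = 0 -> x = 0) ->
  has_resolution 0 M.
Proof.
move=> P_proj f_surj f_inj.
exists (fun i => if i is 0 then P else zero_mod), (fun i => zero_hom _ _), f.
split=> //.
- by case=> [//|i]; apply: free_projective.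
- by case=> [//|i] _; apply: zero_modP.
- move=> a y; split=> [/f_inj ->|[x <-]]; last by rewrite raddf0.
  by exists 0.
- move=> i a y; split=> _ //; exists 0; apply/esym.
  by case: i y => [|i] y; apply: zero_modP.
Qed.

Lemma has_resolutionS n (P M : lmodule (Qk k)) (f : lmhom P M) :
  lm_projective P -> lm_surjective f -> has_resolution n (lm_ker f) ->
  has_resolution n.+1 M.
Proof.
move=> P_proj f_surj [Q [d [e [Q_proj Q0 e_surj e_ex d_ex]]]].
pose P' i := if i is i'.+1 then Q i' else P.
pose d' i : lmhom (P' i.+1) (P' i) :=
  match i return lmhom (P' i.+1) (P' i) with
  | 0 => lm_comp e (ker_in f)
  | i'.+1 => d i'
  end.
exists P', d', f; split=> //.
- by case=> [//|i]; apply: Q_proj.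
- by case=> [//|i]; apply: Q0.
- move=> a y; split=> [fy|[x <-]]; last exact: ker_inP.
  by have [x ex] := e_surj a (ker_mk fy); exists x; rewrite /= ex.
- case=> [|i]; last exact: d_ex.
  move=> a y; split=> [ey|]; last first.
    move/(e_ex a y) => ey; change (ker_in f a (e a y) = 0).
    by rewrite ey raddf0.
  apply/(e_ex a y); apply: ker_in_inj; rewrite raddf0; exact: ey.
Qed.

(** Each syzygy gains one unit of depth by [depth_ker]; after n of them the depth is k and
    [free_of_depth] ends the resolution. *)
Lemma resolution_of_depth n d (M : lmodule (Qk k)) :
  (d + n = k)%N -> depth M d -> has_resolution n M.
Proof.
elim: n d M => [|n IH] d M dn dM.
  have dk : d = k by lia.
  subst d; have [I [deg [f [f_surj f_inj]]]] := free_of_depth dM.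
  exact: has_resolution0 (@free_projective k I deg) f_surj f_inj.
(* The free cover has every element of M as a generator. *)
pose I : choiceType := {classic {m : int & M m}}.
pose deg (p : I) : int := tag (p : {m : int & M m}).
pose gen (p : I) : M (deg p) := tagged (p : {m : int & M m}).
have f_surj : lm_surjective (free_desc gen).
  move=> m y; pose p : I := existT _ m y.
  by exists (free_gen k deg p); apply: (free_desc_gen gen p).
apply: (has_resolutionS (@free_projective k I deg) f_surj).
apply: (IH d.+1); first by lia.
by apply: depth_ker => //; [apply: free_depth | lia].
Qed.

End Resolution.

Local Close Scope ring_scope.

Theorem corollary4p7 (k : nat) (M : lmodule (Qk k)) :
  exists (P : nat -> lmodule (Qk k))
         (d : forall i : nat, lmhom (P i.+1) (P i))
         (e : lmhom (P 0) M),
    proj_resolution k d e.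
(* Depth 0 is an empty condition, so every module qualifies with n = k. *)
Proof. exact: (resolution_of_depth (add0n k)). Qed.
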